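(* Fix $\rho\in(0,1)$ and let $x_k=k+\rho-1$, $y_k=k\rho$ for $k\ge1$ (the Charlier specialization). For each $n$ let $w\in\mathbb{YF}_n$ be a random Fibonacci word distributed according to the clone coherent measure $$M_n(w)=\dim(w)\,\frac{s_w(\vec x\mid\vec y)}{x_1x_2\cdots x_n}.$$ Then for each fixed $k\ge1$ the runs $(r_1(w),\ldots,r_k(w))$ satisfy the joint convergence in distribution $$\left(\frac{r_j(w)}{n-\sum_{i=1}^{j-1}r_i(w)}\right)_{j=1}^{k}\ \xrightarrow[n\to\infty]{d}\ (\eta_{\rho;1},\ldots,\eta_{\rho;k}),$$ where $\eta_{\rho;1},\eta_{\rho;2},\ldots$ are i.i.d. random variables on $[0,1]$ with distribution $$\rho\,\delta_0(d\alpha)+(1-\rho)\,\rho\,(1-\alpha)^{\rho-1}\,d\alpha .$$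
   Context: A Fibonacci word is a finite word $w$ in the letters $1,2$; its weight $|w|$ is the sum of its letters; $\mathbb{YF}_n$ is the set of Fibonacci words of weight $n$. $\dim$ is defined by $\dim(\varnothing)=1$, $\dim(1v)=\dim(v)$, $\dim(2v)=(|v|+1)\dim(v)$. For sequences $\vec x,\vec y$: $A_\ell$ ($A_0=1$) is the determinant of the $\ell\times\ell$ tridiagonal matrix with diagonal $x_1,\ldots,x_\ell$, superdiagonal $y_1,\ldots,y_{\ell-1}$ and subdiagonal entries $1$; $B_k(m)$ is the determinant of the $(k+1)\times(k+1)$ tridiagonal matrix with diagonal $y_{m+1},x_{m+3},\ldots,x_{m+k+2}$, superdiagonal $x_{m+1}y_{m+2},y_{m+3},\ldots,y_{m+k+1}$, subdiagonal entries $1$. Clone Schur functions: $s_{1^k}=A_k$, $s_{1^k2u}=B_k(|u|)\,s_u$. For the Charlier specialization with $\rho\in(0,1]$ all $s_w$ are positive and $M_n$ is a probability measure on $\mathbb{YF}_n$. Runs: write uniquely $w=1^{r_1}21^{r_2}2\cdots21^{r_p}$ with $r_j\in\mathbb Z_{\ge0}$; then $r_j(w)=r_j$ for $j\le p$ and $r_j(w)=0$ for $j>p$. A ratio with denominator $0$ is set to be $0$. *)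

(* Defs.v *)
From HB Require Import structures.
From mathcomp Require Import all_boot all_order all_algebra.
From mathcomp Require Import all_classical all_reals all_analysis measurable_realfun.
From mathcomp Require Import lra zify.

Set Implicit Arguments.
Unset Strict Implicit.
Unset Printing Implicit Defensive.

Import Order.TTheory GRing.Theory Num.Theory.
Import numFieldNormedType.Exports.

Local Open Scope classical_set_scope.

Inductive letter := One | Two.

Definition bool_of_letter (a : letter) : bool := if a is Two then true else false.
Definition letter_of_bool (b : bool) : letter := if b then Two else One.

Lemma bool_of_letterK : cancel bool_of_letter letter_of_bool.
Proof. by case. Qed.

HB.instance Definition _ := Finite.copy letter (can_type bool_of_letterK).

Definition letter_val (a : letter) : nat := if a is Two then 2 else 1.

Definition weight (w : seq letter) : nat := sumn (map letter_val w).

(* A word of weight n has at most n letters (size_weight), so bounding the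
   length by n only serves to make the type finite; see YF_ex and YF_inj. *)
Definition YF (n : nat) := {w : n.-bseq letter | weight w == n}.

Definition YF_word (n : nat) (w : YF n) : seq letter := val (val w).
Coercion YF_word : YF >-> seq.

Lemma size_weight (w : seq letter) : (size w <= weight w)%N.
Proof. by elim: w => //= -[] w; rewrite /weight /=; lia. Qed.

Lemma YF_inj n : injective (@YF_word n).
Proof. by move=> u v /val_inj/val_inj. Qed.

Lemma weight_YF n (w : YF n) : weight w = n.
Proof. by apply/eqP; exact: (valP w). Qed.

Lemma YF_ex n (s : seq letter) : weight s = n -> exists w : YF n, w = s :> seq letter.
Proof.
move=> sn; have szs : (size s <= n)%N by rewrite -sn size_weight.
have ws : weight (Bseq szs) == n by apply/eqP.
by exists (exist _ (Bseq szs) ws).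
Qed.

Fixpoint fib_dim (w : seq letter) : nat :=
  match w with
  | [::] => 1
  | One :: v => fib_dim v
  | Two :: v => (weight v).+1 * fib_dim v
  end.

(* The sequence [:: r_1; ...; r_p] with w = 1^r_1 2 1^r_2 2 ... 2 1^r_p. *)
Fixpoint runs (w : seq letter) : seq nat :=
  match w with
  | [::] => [:: 0]
  | One :: v => incr_nth (runs v) 0
  | Two :: v => 0 :: runs v
  end.

Definition run (j : nat) (w : seq letter) : nat := nth 0 (runs w) j.-1.

Fixpoint word_of_runs (rs : seq nat) : seq letter :=
  match rs with
  | [::] => [::]
  | [:: r] => nseq r One
  | r :: rs' => nseq r One ++ Two :: word_of_runs rs'
  end.

Lemma runs_nil w : runs w != [::].
Proof. by elim: w => [|[] w] //=; case: (runs w). Qed.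

Lemma runsK : cancel runs word_of_runs.
Proof.
elim=> [|[] w IH] //=.
  rewrite -[in RHS]IH; have := runs_nil w.
  by case: (runs w) => //= r [].
by have := runs_nil w; move: IH; case: (runs w) => //= r rs ->.
Qed.

Lemma word_of_runsK rs : rs != [::] -> runs (word_of_runs rs) = rs.
Proof.
elim: rs => // r [_ _|r' rs /(_ isT) IH _].
  by rewrite /=; elim: r => //= r ->.
rewrite [word_of_runs _]/= -/(word_of_runs (r' :: rs)).
by elim: r => [|r IHr] /=; [rewrite IH|rewrite IHr].
Qed.

Local Open Scope ring_scope.

Section clone_schur.
Context {R : comPzRingType}.

(* d and u list the diagonal and the superdiagonal from index 0. *)
Definition tridiag (l : nat) (d u : nat -> R) : 'M[R]_l :=
  \matrix_(i, j) (if i == j :> nat then d i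
                  else if j == i.+1 :> nat then u i
                  else if i == j.+1 :> nat then 1 else 0).

(* Only the values at indices >= 1 of the sequences x and y matter. *)
Variables x y : nat -> R.

Definition cloneA (l : nat) : R :=
  \det (tridiag l (fun i => x i.+1) (fun i => y i.+1)).

Definition cloneB (k m : nat) : R :=
  \det (tridiag k.+1
    (fun i => if i is 0 then y m.+1 else x (m + i + 2)%N)
    (fun i => if i is 0 then x m.+1 * y m.+2 else y (m + i + 2)%N)).

(* clone_schur_rec k w is the clone Schur function of the word 1^k w. *)
Fixpoint clone_schur_rec (k : nat) (w : seq letter) : R :=
  match w with
  | [::] => cloneA k
  | One :: v => clone_schur_rec k.+1 v
  | Two :: u => cloneB k (weight u) * clone_schur_rec 0%N u
  end.

Definition clone_schur (w : seq letter) : R := clone_schur_rec 0%N w.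

Lemma clone_schur_recE k w :
  clone_schur_rec k w = clone_schur (nseq k One ++ w).
Proof.
suff H j : clone_schur_rec (j + k) w = clone_schur_rec j (nseq k One ++ w).
  exact: (H 0).
by elim: k j => [|k IH] j /=; rewrite ?addn0// addnS -addSn IH.
Qed.

Lemma clone_schur_ones k : clone_schur (nseq k One) = cloneA k.
Proof. by rewrite -[nseq k One]cats0 -clone_schur_recE. Qed.

Lemma clone_schur_two k u :
  clone_schur (nseq k One ++ Two :: u) = cloneB k (weight u) * clone_schur u.
Proof. by rewrite -clone_schur_recE. Qed.

End clone_schur.

Definition clone_measure {R : fieldType} (x y : nat -> R) (n : nat) (w : YF n) : R :=
  (fib_dim w)%:R * clone_schur x y w / \prod_(1 <= i < n.+1) x i.

Definition charlier_x {R : pzRingType} (rho : R) (k : nat) : R := k%:R + rho - 1.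
Definition charlier_y {R : pzRingType} (rho : R) (k : nat) : R := k%:R * rho.

(* The ratio r_j / (n - (r_1 + ... + r_(j-1))); division by 0 yields 0. *)
Definition run_ratio {R : fieldType} (n : nat) (w : seq letter) (j : nat) : R :=
  (run j w)%:R / (n%:R - \sum_(1 <= i < j) (run i w)%:R).

Definition run_ratios {R : fieldType} (k n : nat) (w : YF n) : 'rV[R]_k :=
  \row_(j < k) run_ratio n w j.+1.

Section eta_law.
Context {R : realType}.
Local Notation mu := (@lebesgue_measure R).
Variable rho : R.

Definition eta_density (a : R) : R := rho * (1 - a) `^ (rho - 1).

(* The argument rho01 only serves to attach the probability structure below. *)
Definition eta_law (rho01 : 0 < rho < 1) (A : set (measurableTypeR R)) : \bar R :=
  (rho%:E * \d_(0%R : R) A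
   + (1 - rho)%R%:E * \int[mu]_(a in A `&` `[0%R, 1%R]) (eta_density a)%:E)%E.

Hypothesis rho01 : 0 < rho < 1.

Let rho_gt0 : 0 < rho. Proof. by case/andP: rho01. Qed.
Let rho_lt1 : rho < 1. Proof. by case/andP: rho01. Qed.

Lemma eta_density_ge0 a : 0 <= eta_density a.
Proof. by rewrite mulr_ge0 ?powR_ge0// ltW. Qed.

Lemma measurable_eta_density : measurable_fun setT eta_density.
Proof.
apply: measurable_funM => //.
apply: (@measurableT_comp _ _ _ _ _ _ (fun z => z `^ (rho - 1))) => //.
exact: measurable_funB.
Qed.

Let mEeta D : measurable_fun D (EFin \o eta_density).
Proof. by apply/measurable_funTS/measurable_EFinP; exact: measurable_eta_density. Qed.

Let itv_n (n : nat) : set R := `[0, 1 - n.+2%:R^-1].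

Let itv_bigcup : \bigcup_n itv_n n = `[0, 1[%classic.
Proof.
apply/seteqP; split=> [z [n _]|z]; rewrite /itv_n /= !in_itv/= => /andP[z0 z1].
  by rewrite z0 (le_lt_trans z1)// gtrBl invr_gt0.
have d0 : 0 < 1 - z by rewrite subr_gt0.
exists (Num.truncn (1 - z)^-1) => //=; rewrite in_itv/= z0 /=.
rewrite lerBrDr -lerBrDl -[leRHS]invrK lef_pV2 ?posrE ?invr_gt0//.
apply/ltW/(lt_le_trans (Num.Theory.truncnS_gt _)).
by rewrite ler_nat.
Qed.

Let F (a : R) : R := - (1 - a) `^ rho.

Let dF (a : R) : a < 1 -> is_derive a 1 F (eta_density a).
Proof.
move=> a1; have a0 : 0 < 1 - a by rewrite subr_gt0.
rewrite /F /eta_density.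
have h := is_derive1_powR rho a0.
have g : is_derive a (1:R) (fun z : R => 1 - z) (-1).
  by rewrite -[X in is_derive _ _ _ X]sub0r; exact: is_deriveB.
have c := @is_derive1_comp R (fun z => z `^ rho) (fun z : R => 1 - z) a _ _ h g.
have := @is_deriveN _ _ _ _ a 1 _ c.
by rewrite mulrN1 opprK.
Qed.

Let integral_itv_n n :
  (\int[mu]_(a in itv_n n) (eta_density a)%:E = (1 - n.+2%:R^-1 `^ rho)%:E)%E.
Proof.
have n1 : (n.+2%:R^-1 : R) < 1 by rewrite invf_lt1// ltr1n.
have n0 : (0 : R) < n.+2%:R^-1 by rewrite invr_gt0.
have cF a : a < 1 -> {for a, continuous F}.
  move=> a1; apply: differentiable_continuous; apply/derivable1_diffP.
  by have [] := dF a1.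
rewrite (@continuous_FTC2 _ _ F).
- by rewrite /F subr0 powR1 subKr -EFinB opprK addrC.
- by rewrite subr_gt0.
- apply: continuous_in_subspaceT => a; rewrite inE/= in_itv/= => /andP[_ a1].
  have {}a1 : 0 < 1 - a by rewrite subr_gt0 (le_lt_trans a1)// gtrBl.
  apply: cvgM; first exact: cvg_cst.
  apply: (@continuous_comp _ _ _ (fun z : R => 1 - z) (fun z => z `^ (rho - 1))).
    by apply: cvgB; [exact: cvg_cst|exact: cvg_id].
  apply: differentiable_continuous; apply/derivable1_diffP.
  by have [] := is_derive1_powR (rho - 1) a1.
- split.
  + move=> a; rewrite in_itv/= => /andP[_ a1].
    by have [] // := @dF a; rewrite (lt_trans a1)// gtrBl.
  + by apply: cvg_at_right_filter; exact: cF.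
  + by apply: cvg_at_left_filter; apply: cF; rewrite gtrBl.
- move=> a; rewrite in_itv/= => /andP[_ a1].
  have /dF[_] : a < 1 by rewrite (lt_trans a1)// gtrBl.
  by rewrite derive1E.
Qed.

Lemma integral_eta_density :
  (\int[mu]_(a in `[0%R, 1%R]) (eta_density a)%:E = 1)%E.
Proof.
rewrite -integral_itv_bndo_bndc; last exact: mEeta.
rewrite -itv_bigcup.
have cv : (\int[mu]_(a in itv_n n) (eta_density a)%:E)%E @[n --> \oo] -->
    (\int[mu]_(a in \bigcup_n itv_n n) (eta_density a)%:E)%E.
  apply: (@ge0_nondecreasing_set_cvg_integral _ (measurableTypeR R) R itv_n
    (EFin \o eta_density) mu) => //.
  - move=> m n mn; apply/subsetPset; apply: subset_itvl.
    by rewrite bnd_simp lerD2l lerN2 lef_pV2 ?posrE// ler_nat !ltnS.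
  - by move=> n; exact: measurable_itv.
  - by move=> i; exact: mEeta.
  - by move=> i a _; rewrite lee_fin eta_density_ge0.
rewrite -(cvg_lim _ cv)//; apply/cvg_lim => //.
rewrite (funext integral_itv_n).
apply: cvg_EFin; first by near=> n.
rewrite /comp/= -[X in _ --> X]subr0; apply: cvgB; first exact: cvg_cst.
apply: ((cvg_at_rightP (fun z : R => z `^ rho) 0 0).1 (powR_cvg0 rho_gt0)
  (fun n : nat => n.+2%:R^-1)).
split; first by move=> n; rewrite invr_gt0.
by have := @cvg_harmonic R; rewrite -cvg_shiftS.
Unshelve. all: by end_near. Qed.

Definition eta_ac (A : set (measurableTypeR R)) : \bar R :=
  (\int[mu]_(a in A `&` `[0%R, 1%R]) (eta_density a)%:E)%E.

Let eta_ac0 : eta_ac set0 = 0%E.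
Proof. by rewrite /eta_ac set0I integral_set0. Qed.

Let eta_ac_ge0 A : (0 <= eta_ac A)%E.
Proof. by apply: integral_ge0 => a _; rewrite lee_fin eta_density_ge0. Qed.

Let eta_ac_sigma_additive : semi_sigma_additive eta_ac.
Proof.
move=> /= G mG tG mUG; rewrite /eta_ac; apply: cvg_toP.
  apply: ereal_nondecreasing_is_cvgn => m n mn.
  by apply: lee_sum_nneg_natr => // k _ _; exact: eta_ac_ge0.
rewrite setI_bigcupl ge0_integral_bigcup//=.
- by move=> i; apply: measurableI => //; exact: measurable_itv.
- by apply: mEeta.
- by move=> a _; rewrite lee_fin eta_density_ge0.
- by apply: trivIset_setIr.
Qed.

HB.instance Definition _ := isMeasure.Build _ _ _
  eta_ac eta_ac0 eta_ac_ge0 eta_ac_sigma_additive.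

Let rho_ge0 : 0 <= rho. Proof. exact: ltW. Qed.
Let rhoC_ge0 : 0 <= 1 - rho. Proof. by rewrite subr_ge0 ltW. Qed.

Let eta_lawE : eta_law rho01 = measure_add
  (mscale (NngNum rho_ge0) \d_(0 : measurableTypeR R)) (mscale (NngNum rhoC_ge0) eta_ac).
Proof. by apply/funext => A; rewrite measure_addE. Qed.

Let eta_law0 : eta_law rho01 set0 = 0%E.
Proof. by rewrite eta_lawE; exact: measure0. Qed.

Let eta_law_ge0 A : (0 <= eta_law rho01 A)%E.
Proof. by rewrite eta_lawE; exact: measure_ge0. Qed.

Let eta_law_sigma_additive : semi_sigma_additive (eta_law rho01).
Proof. rewrite eta_lawE; exact: measure_semi_sigma_additive. Qed.

HB.instance Definition _ := isMeasure.Build _ _ _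
  (eta_law rho01) eta_law0 eta_law_ge0 eta_law_sigma_additive.

Let eta_law_setT : eta_law rho01 setT = 1%E.
Proof.
by rewrite /eta_law diracT setTI integral_eta_density !mule1 -EFinD addrC subrK.
Qed.

HB.instance Definition _ :=
  Measure_isProbability.Build _ _ _ (eta_law rho01) eta_law_setT.

End eta_law.

Section iid_law.
Context {d : measure_display} {T : measurableType d} {R : realType}.

Definition tuple_cons (n : nat) (p : T * n.-tuple T) : n.+1.-tuple T :=
  [tuple of p.1 :: p.2].

Lemma measurable_tuple_cons n : measurable_fun setT (@tuple_cons n).
Proof. by apply: measurable_cons; [exact: measurable_fst|exact: measurable_snd]. Qed.

HB.instance Definition _ n :=
  isMeasurableFun.Build _ _ _ _ (@tuple_cons n) (@measurable_tuple_cons n).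

(* The product measure on n-tuples, i.e. the joint law of n independent
   random variables with common law P; see iid_law_box. *)
Fixpoint iid_law (P : probability T R) (n : nat) : probability (n.-tuple T) R :=
  match n with
  | 0 => \d_[tuple]
  | m.+1 => distribution (P \x iid_law P m)%E (@tuple_cons m)
  end.

Definition box n (A : 'I_n -> set T) : set (n.-tuple T) :=
  [set t | forall i, A i (tnth t i)].

Lemma measurable_box n (A : 'I_n -> set T) :
  (forall i, measurable (A i)) -> measurable (box A).
Proof.
move=> mA.
have -> : box A = \bigcap_(i in setT) ((@tnth n T)^~ i @^-1` A i).
  by apply/seteqP; split=> t At i; [move=> _|]; exact: At.
apply: fin_bigcap_measurable => // i _.
by rewrite -[X in measurable X]setTI; exact: measurable_tnth.
Qed.

Lemma iid_law_box (P : probability T R) n (A : 'I_n -> set T) :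
  (forall i, measurable (A i)) ->
  iid_law P n (box A) = (\prod_(i < n) P (A i))%E.
Proof.
elim: n A => [|n IH] A mA.
  by rewrite big_ord0 /= diracE mem_set//; case.
rewrite big_ord_recl -IH; last by move=> i; exact: mA.
rewrite -product_measure1E//; last exact: measurable_box.
rewrite /= /distribution /pushforward.
congr (_ _); apply/seteqP; split => -[a t] /=.
  move=> At; split=> [|i]; first by have := At ord0; rewrite tnth0.
  by have := At (lift ord0 i); rewrite tnthS.
case=> a0 At i; case: (unliftP ord0 i) => [j ->|->]; last by rewrite tnth0.
by rewrite tnthS; exact: At.
Qed.

End iid_law.

(* Weak convergence to nu, on R^k, of the law of X n when the point w of the
   finite set W n has probability p n w. *)
Definition cvg_in_law {R : realType} (k : nat) (W : nat -> finType)
    (p : forall n, W n -> R) (X : forall n, W n -> 'rV[R]_k)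
    (nu : probability (k.-tuple (measurableTypeR R)) R) : Prop :=
  forall f : 'rV[R]_k -> R, continuous f -> bounded_fun f ->
    (\sum_(w : W n) p n w * f (X n w)) @[n --> \oo] -->
    \int[nu]_t f (\row_(j < k) tnth t j).
Arguments cvg_in_law {R k} W p X nu.

(* Main.v *)
Require Import Defs.
From mathcomp Require Import all_boot all_order all_algebra.
From mathcomp Require Import all_classical all_reals all_analysis.
From mathcomp Require Import measurable_realfun ring lra zify.
Import Order.TTheory GRing.Theory Num.Theory.
Import numFieldNormedType.Exports.
Local Open Scope classical_set_scope.
Local Open Scope ring_scope.

(* A word 1^r 2 u of weight n has M_n-mass p_n(r) M_m(u) with m = n - 2 - r and
   p_n(r) = [first_run n r].  So after its first run and the following 2 the
   word is again clone distributed, and the theorem follows by induction on k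
   from the law of r_1.
   For the Charlier parameters the sequences B_r(m) satisfy
   B_(r+1) = rho B_r + D_(r+1) with D_r = rho (1 - rho) (m+r+1)! / (m+1)!.
   The part q_n(r) = [first_run_ac n r] of p_n(r) that comes from D_r equals
   (rho (1 - rho) / n) h(m) / h(n), where h(j) = (rho)_j / j! is
   [rising_ratio j]; since h(j) (j+1)^(1-rho) decreases to a positive limit,
   n q_n(floor(n a)) tends to (1 - rho) rho (1 - a)^(rho - 1) with an integrable
   bound.  The remaining mass tends to rho, and p_n(0) - q_n(0) tends to rho as
   well, so this mass concentrates at r = 0 and yields the atom. *)

(** * Enumeration of Fibonacci words and their splitting at the first 2 *)

Fixpoint fib_words (n : nat) : seq (seq letter) :=
  match n with
  | 0 => [:: [::]]
  | 1 => [:: [:: One]]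
  | (n'.+1 as m).+1 =>
      map (cons One) (fib_words m) ++ map (cons Two) (fib_words n')
  end.

Lemma fib_words_ind (P : nat -> Prop) :
  P 0 -> P 1 -> (forall n, P n -> P n.+1 -> P n.+2) -> forall n, P n.
Proof.
move=> P0 P1 PS n; suff: P n /\ P n.+1 by case.
by elim: n => [//|n [Pn PSn]]; split=> //; exact: PS.
Qed.

Lemma mem_fib_words n w : (w \in fib_words n) = (weight w == n).
Proof.
elim/fib_words_ind: n w => [||n IHn IHn1] w.
- by rewrite inE; case: w => // -[].
- by rewrite inE; case: w => // -[] // [|[] w].
rewrite [fib_words _]/= -/(fib_words n.+1) mem_cat.
case: w => [|a w].
  by rewrite /weight /=; apply/negbTE/norP; split; apply/mapP => -[].
case: a.
  have -> : (One :: w \in [seq Two :: i | i <- fib_words n]) = false.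
    by apply/negbTE/mapP => -[].
  rewrite orbF mem_map; last by move=> ? ? [].
  by rewrite IHn1 /weight /= add1n eqSS.
have -> : (Two :: w \in [seq One :: i | i <- fib_words n.+1]) = false.
  by apply/negbTE/mapP => -[].
rewrite orFb mem_map; last by move=> ? ? [].
by rewrite IHn /weight /= add2n !eqSS.
Qed.

Lemma fib_words_uniq n : uniq (fib_words n).
Proof.
elim/fib_words_ind: n => // n IHn IHn1.
rewrite [fib_words _]/= -/(fib_words n.+1) cat_uniq !map_inj_uniq ?IHn ?IHn1;
  try by move=> ? ? [].
by rewrite andbT; apply/hasPn => _ /mapP[w _ ->]; apply/mapP => -[].
Qed.

(** Replaces the finite subtype by a list built by recursion on the weight, so that sums can be
    split along the first letter. *)
Lemma sum_YF (V : nmodType) n (F : seq letter -> V) :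
  \sum_(w : YF n) F w = \sum_(w <- fib_words n) F w.
Proof.
rewrite -big_enum /= -(big_map (@YF_word n) predT F); apply: perm_big.
apply: uniq_perm; rewrite ?fib_words_uniq//.
  by rewrite map_inj_uniq -?enumT ?enum_uniq//; exact: YF_inj.
move=> w; rewrite mem_fib_words; apply/mapP/eqP => [[u _ ->]|wn].
  exact: weight_YF.
by have [u uw] := YF_ex wn; exists u; rewrite -?enumT ?mem_enum.
Qed.

(** A word without a 2 is 1^n; any other is 1^r 2 u with 0 <= r <= n - 2. In the induction, words
    starting with 2 give the term r = 0 and words starting with 1 shift r by one. *)
Lemma sum_fib_words_run (V : nmodType) n (F : seq letter -> V) :
  \sum_(w <- fib_words n) F w = F (nseq n One) +
  \sum_(r < n.-1) \sum_(u <- fib_words (n - 2 - r)) F (nseq r One ++ Two :: u).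
Proof.
elim/fib_words_ind: n F => [||n _ IH] F.
- by rewrite big_seq1 big_ord0 addr0.
- by rewrite big_seq1 big_ord0 addr0.
rewrite [fib_words _]/= -/(fib_words n.+1) big_cat !big_map IH /=.
rewrite [in RHS]big_ord_recl /= -addrA; congr (_ + _).
rewrite addrC; congr (_ + _); first by rewrite subn0 subn2.
apply: eq_bigr => i _; rewrite /bump /= add1n.
by rewrite (_ : n.+1 - 2 - i = n.+2 - 2 - i.+1)%N//; lia.
Qed.

(** * Three-term recurrences for tridiagonal determinants *)

Section tridiagonal.
Context {R : comPzRingType}.
Implicit Types d u : nat -> R.

Lemma det_tridiag0 d u : \det (tridiag 0 d u) = 1.
Proof. exact: det_mx00. Qed.

Lemma det_tridiag1 d u : \det (tridiag 1 d u) = d 0.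
Proof. by rewrite det_mx11 mxE. Qed.

(** Laplace expansion along the last row, which has two nonzero entries; the minor of the
    subdiagonal entry 1 is then expanded along its last column, where only [u l] survives. *)
Lemma det_tridiagSS l d u :
  \det (tridiag l.+2 d u) =
  d l.+1 * \det (tridiag l.+1 d u) - u l * \det (tridiag l d u).
Proof.
have geE p (i : 'I_p) : (p <= i)%N = false by rewrite leqNgt ltn_ord.
rewrite (expand_det_row _ ord_max) big_ord_recr big_ord_recr /= big1 ?add0r.
  rewrite addrC; congr (_ + _).
    rewrite mxE /= eqxx /cofactor addnn -signr_odd odd_double mul1r.
    congr (_ * \det _); apply/matrixP => i j.
    by rewrite !mxE /= /bump !geE !add0n.
  rewrite mxE /= (_ : (l.+1 == l) = false); last by lia.
  rewrite (_ : (l == l.+2) = false) ?eqxx ?mul1r; last by lia.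
  rewrite /cofactor /= addSn addnn -signr_odd /= odd_double expr1 mulN1r.
  congr (- _); rewrite (expand_det_col _ ord_max) big_ord_recr /= big1 ?add0r.
    congr (_ * _).
      rewrite !mxE /= /bump /= ltnn leqnn /= add0n add1n.
      by rewrite (@ltn_eqF l l.+1)// eqxx.
    rewrite /cofactor addnn -signr_odd odd_double mul1r.
    congr (\det _); apply/matrixP => i j; rewrite !mxE /= /bump.
    by rewrite !geE ![(l < _)%N]ltnNge !(ltnW (ltn_ord _)) !add0n.
  move=> i _; rewrite !mxE /= /bump leqnn add1n.
  have il := ltn_ord i.
  rewrite (_ : (l < i)%N = false) ?add0n; last by lia.
  by do ![case: eqP => [?|_]; [lia|]]; rewrite mul0r.
move=> i _; rewrite !mxE /=; have il := ltn_ord i.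
by do ![case: eqP => [?|_]; [lia|]]; rewrite mul0r.
Qed.

End tridiagonal.

Section clone_recurrence.
Context {R : comPzRingType}.
Variables x y : nat -> R.

Lemma cloneASS l :
  cloneA x y l.+2 = x l.+2 * cloneA x y l.+1 - y l.+1 * cloneA x y l.
Proof. exact: det_tridiagSS. Qed.

Lemma cloneB0 m : cloneB x y 0 m = y m.+1.
Proof. exact: det_tridiag1. Qed.

(** Separate from [cloneBSS] because the first superdiagonal entry carries the extra factor
    [x m.+1]. *)
Lemma cloneB1 m : cloneB x y 1 m = x (m + 3)%N * y m.+1 - x m.+1 * y m.+2.
Proof.
by rewrite /cloneB det_tridiagSS det_tridiag1 det_tridiag0 mulr1 -addnA.
Qed.

Lemma cloneBSS k m :
  cloneB x y k.+2 m =
  x (m + k + 4)%N * cloneB x y k.+1 m - y (m + k + 3)%N * cloneB x y k m.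
Proof.
by rewrite /cloneB det_tridiagSS; congr (x _ * _ - y _ * _); lia.
Qed.

End clone_recurrence.

(** * Total mass of the clone measure for arbitrary parameters *)

Section clone_mass.
Context {R : comPzRingType}.
Variables x y : nat -> R.

Definition x_prod (n : nat) : R := \prod_(1 <= i < n.+1) x i.

Lemma x_prod0 : x_prod 0 = 1.
Proof. by rewrite /x_prod big_geq. Qed.

Lemma x_prodS n : x_prod n.+1 = x_prod n * x n.+1.
Proof. by rewrite /x_prod big_nat_recr. Qed.

Lemma fib_dim_two r u :
  fib_dim (nseq r One ++ Two :: u) = ((weight u).+1 * fib_dim u)%N.
Proof. by elim: r. Qed.

Lemma fib_dim_ones n : fib_dim (nseq n One) = 1%N.
Proof. by elim: n. Qed.

Definition clone_total n : R :=
  \sum_(w <- fib_words n) (fib_dim w)%:R * clone_schur x y w.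

(** Summation runs over the weight m of the remainder rather than over r: then n enters only through
    [cloneA] and the first index of [cloneB], on which the three-term recurrences act. *)
Lemma clone_total_rec n : clone_total n = cloneA x y n +
  \sum_(m < n.-1) m.+1%:R * cloneB x y (n - 2 - m)%N m * clone_total m.
Proof.
rewrite /clone_total sum_fib_words_run fib_dim_ones clone_schur_ones mul1r.
congr (_ + _); rewrite (reindex_inj rev_ord_inj); apply: eq_bigr => i _ /=.
have ilt := ltn_ord i.
have -> : (n - 2 - (n.-1 - i.+1) = i)%N by lia.
have -> : (n.-1 - i.+1 = n - 2 - i)%N by lia.
rewrite mulr_sumr big_seq [RHS]big_seq.
apply: eq_bigr => u; rewrite mem_fib_words => /eqP uw.
rewrite fib_dim_two clone_schur_two uw natrM; ring.
Qed.

(* Both sides obey the three-term recurrence of the continuants up to the same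
   boundary terms, which come from the two shortest initial runs. *)
Lemma clone_totalE n : clone_total n = x_prod n.
Proof.
have [m] := ubnP n; elim: m n => // m IH n; rewrite ltnS => nm.
have A0 : cloneA x y 0 = 1 by exact: det_tridiag0.
have A1 : cloneA x y 1 = x 1 by exact: det_tridiag1.
case: n nm => [|[|[|n]]] nm.
- by rewrite clone_total_rec big_ord0 addr0 x_prod0 A0.
- by rewrite clone_total_rec big_ord0 addr0 x_prodS x_prod0 A1 mul1r.
- rewrite clone_total_rec /= big_ord1 (IH 0); last by lia.
  rewrite cloneASS cloneB0 A0 A1.
  by rewrite !x_prodS x_prod0 /=; ring.
have E1 := clone_total_rec n.+1; have E2 := clone_total_rec n.+2.
rewrite IH in E1; last by lia.
rewrite IH in E2; last by lia.
rewrite [n.+2.-1]/= big_ord_recr /= in E2; rewrite /= in E1.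
rewrite clone_total_rec [n.+3.-1]/= 2!big_ord_recr /= cloneASS.
have -> : (n.+3 - 2 - n = 1)%N by lia.
have -> : (n.+3 - 2 - n.+1 = 0)%N by lia.
rewrite (_ : n.+2 - 2 - n = 0)%N in E2; last by lia.
(* For m < n the recurrence [cloneBSS] has the same coefficients x_(n+3) and y_(n+2) as that of
   A_(n+3), so these terms recombine into the sums of [E2] and [E1]; the weights n and n + 1 leave
   the boundary terms B_1 and B_0. *)
rewrite [X in _ + (X + _ + _)](_ : _ =
    x n.+3 * (\sum_(i < n) i.+1%:R * cloneB x y (n.+2 - 2 - i) i * clone_total i)
  - y n.+2 * (\sum_(i < n) i.+1%:R * cloneB x y (n.+1 - 2 - i) i * clone_total i)).
  rewrite cloneB1 !cloneB0 (IH n.+1); last by lia.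
  have Tn : clone_total n = x_prod n by apply: IH; lia.
  rewrite cloneB0 Tn in E2; rewrite Tn.
  move: E1 E2; set S1 := \sum_(i < n) _; set S2 := \sum_(i < n) _ => E1 E2.
  have -> : (n + 3 = n.+3)%N by lia.
  have -> : x_prod n.+3 = x_prod n.+2 * x n.+3 by exact: x_prodS.
  have {}E1 : cloneA x y n.+1 = x_prod n.+1 - S1 by rewrite E1 addrK.
  by rewrite E2 E1 x_prodS -[n.+2%:R]natr1; ring.
rewrite !mulr_sumr -sumrB; apply: eq_bigr => i _.
have ilt := ltn_ord i.
have -> : (n.+3 - 2 - i = (n - i.+1).+2)%N by lia.
have -> : (n.+2 - 2 - i = (n - i.+1).+1)%N by lia.
have -> : (n.+1 - 2 - i = n - i.+1)%N by lia.
rewrite cloneBSS.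
have -> : (i + (n - i.+1) + 4 = n.+3)%N by lia.
have -> : (i + (n - i.+1) + 3 = n.+2)%N by lia.
ring.
Qed.

End clone_mass.

(** * The Charlier specialization: exact law of the first run *)

Section charlier.
Context {R : realFieldType}.
Variable rho : R.
Hypothesis rho01 : 0 < rho < 1.
Local Notation x := (charlier_x rho).
Local Notation y := (charlier_y rho).

Let rho_gt0 : 0 < rho. Proof. by case/andP: rho01. Qed.
Let rho_lt1 : rho < 1. Proof. by case/andP: rho01. Qed.

Lemma charlier_xS k : x k.+1 = k%:R + rho.
Proof. by rewrite /charlier_x -natr1; ring. Qed.

Lemma charlier_x_prod_gt0 n : 0 < x_prod x n.
Proof.
elim: n => [|n IH]; first by rewrite x_prod0.
by rewrite x_prodS mulr_gt0// charlier_xS ltr_wpDl.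
Qed.

(** The recurrence has characteristic polynomial (t - rho)(t - (n + 1)), whose root rho does not
    depend on n. *)
Lemma charlier_cloneA n : cloneA x y n = rho ^+ n.
Proof.
elim/fib_words_ind: n => [||n IHn IHn1].
- exact: det_tridiag0.
- by rewrite /cloneA det_tridiag1 charlier_xS add0r.
- by rewrite cloneASS IHn IHn1 charlier_xS /charlier_y !exprS; ring.
Qed.

(** For k >= 1 this is B_k(m) - rho B_(k-1)(m), a difference that the recurrence multiplies by its
    other characteristic root, m + k + 1 in passing from k - 1 to k. The value at k = 0 continues
    the product formula. *)
Definition charlier_D (k m : nat) : R :=
  rho * (1 - rho) * \prod_(i < k) (m + i + 2)%:R.

Lemma charlier_D_ge0 k m : 0 <= charlier_D k m.
Proof.
by rewrite mulr_ge0 ?prodr_ge0// mulr_ge0 ?subr_ge0 ?ltW.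
Qed.

(* rho ^+ k solves the three-term recurrence of the cloneB, which therefore
   reduces to a first-order recurrence for cloneB k.+1 - rho * cloneB k. *)
Lemma charlier_cloneBS k m :
  cloneB x y k.+1 m = rho * cloneB x y k m + charlier_D k.+1 m.
Proof.
elim: k => [|k IH].
  rewrite cloneB1 cloneB0 /charlier_D big_ord1 addn0 /charlier_y.
  by rewrite /charlier_x !natrD -!natr1; ring.
rewrite cloneBSS (_ : charlier_D k.+2 m = (m + k + 3)%:R * charlier_D k.+1 m).
  rewrite (_ : charlier_D k.+1 m = cloneB x y k.+1 m - rho * cloneB x y k m).
    have -> : (m + k + 4 = (m + k + 3).+1)%N by lia.
    by rewrite charlier_xS /charlier_y; ring.
  by rewrite IH; ring.
rewrite /charlier_D big_ord_recr /=.
have -> : (m + k.+1 + 2 = m + k + 3)%N by lia.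
by ring.
Qed.

(** B_0(m) = (m + 1) rho >= rho (1 - rho), and each step of [charlier_cloneBS] adds [charlier_D] to
    a nonnegative term. This yields nonnegativity of the weights and of
    [first_run - first_run_ac]. *)
Lemma charlier_D_le_cloneB k m : charlier_D k m <= cloneB x y k m.
Proof.
elim: k => [|k IH].
  rewrite cloneB0 /charlier_D big_ord0 mulr1 /charlier_y mulrC.
  by rewrite ler_wpM2r ?(ltW rho_gt0)// (@le_trans _ _ 1) ?ler1n// gerBl ltW.
rewrite charlier_cloneBS lerDr mulr_ge0 ?(ltW rho_gt0)//.
exact: le_trans (charlier_D_ge0 _ _) IH.
Qed.

Lemma charlier_cloneB_ge0 k m : 0 <= cloneB x y k m.
Proof. exact: le_trans (charlier_D_ge0 k m) (charlier_D_le_cloneB k m). Qed.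

Lemma charlier_schur_rec_ge0 k w : 0 <= clone_schur_rec x y k w.
Proof.
elim: w k => [|[] w IH] k /=; first by rewrite charlier_cloneA exprn_ge0 ?ltW.
  exact: IH.
by rewrite mulr_ge0 ?charlier_cloneB_ge0.
Qed.

Definition charlier_weight (n : nat) (w : seq letter) : R :=
  (fib_dim w)%:R * clone_schur x y w / x_prod x n.

Lemma charlier_weight_ge0 n w : 0 <= charlier_weight n w.
Proof.
rewrite divr_ge0 ?(ltW (charlier_x_prod_gt0 _))// mulr_ge0//.
exact: charlier_schur_rec_ge0.
Qed.

Definition charlier_mean (n : nat) (G : seq letter -> R) : R :=
  \sum_(w <- fib_words n) charlier_weight n w * G w.

Lemma charlier_meanE n (G : seq letter -> R) :
  \sum_(w : YF n) clone_measure x y w * G w = charlier_mean n G.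
Proof.
exact: (sum_YF _ _ (fun w => charlier_weight n w * G w)).
Qed.

Lemma charlier_mean_cst n c : charlier_mean n (fun=> c) = c.
Proof.
rewrite /charlier_mean -mulr_suml -mulr_suml.
rewrite [X in X / _](_ : _ = clone_total x y n)// clone_totalE.
by rewrite divff ?mul1r// gt_eqF// charlier_x_prod_gt0.
Qed.

Lemma ler_charlier_mean n (F G : seq letter -> R) :
  (forall w, weight w = n -> F w <= G w) -> charlier_mean n F <= charlier_mean n G.
Proof.
move=> FG; rewrite /charlier_mean big_seq [leRHS]big_seq; apply: ler_sum => w.
rewrite mem_fib_words => /eqP/FG.
by apply: ler_wpM2l; exact: charlier_weight_ge0.
Qed.

Lemma charlier_meanB n (F G : seq letter -> R) :
  charlier_mean n (fun w => F w - G w) = charlier_mean n F - charlier_mean n G.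
Proof.
by rewrite /charlier_mean -sumrB; apply: eq_bigr => w _; rewrite mulrBr.
Qed.

Lemma charlier_mean_norm n (G : seq letter -> R) c :
  (forall w, weight w = n -> `|G w| <= c) -> `|charlier_mean n G| <= c.
Proof.
move=> Gc; rewrite ler_norml; apply/andP; split.
  rewrite -(charlier_mean_cst n (- c)); apply: ler_charlier_mean => w /Gc.
  by rewrite ler_norml => /andP[].
rewrite -[leRHS](charlier_mean_cst n); apply: ler_charlier_mean => w /Gc.
by rewrite ler_norml => /andP[].
Qed.

(* The probability, under the measure on words of weight [n], of an initial run
   of length [r] followed by a 2. *)
Definition first_run (n r : nat) : R :=
  let m := (n - 2 - r)%N in m.+1%:R * cloneB x y r m * x_prod x m / x_prod x n.

Definition mean_after_run (n : nat) (G : seq letter -> R) (r : nat) : R :=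
  charlier_mean (n - 2 - r) (fun u => G (nseq r One ++ Two :: u)).

(** The factors of dim and s_w that come from the prefix 1^r 2 depend on u only through its weight,
    so given the prefix u is again clone distributed. *)
Lemma charlier_mean_run n (G : seq letter -> R) :
  charlier_mean n G = charlier_weight n (nseq n One) * G (nseq n One) +
  \sum_(r < n.-1) first_run n r * mean_after_run n G r.
Proof.
rewrite /mean_after_run /charlier_mean sum_fib_words_run; congr (_ + _).
apply: eq_bigr => r _; rewrite mulr_sumr big_seq [RHS]big_seq.
apply: eq_bigr => u; rewrite mem_fib_words => /eqP uw.
rewrite /charlier_weight /first_run fib_dim_two clone_schur_two uw natrM.
by field; rewrite !gt_eqF// charlier_x_prod_gt0.
Qed.

Definition first_run_ac (n r : nat) : R :=
  let m := (n - 2 - r)%N in m.+1%:R * charlier_D r m * x_prod x m / x_prod x n.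

Lemma first_run_ac_ge0 n r : 0 <= first_run_ac n r.
Proof.
rewrite /first_run_ac divr_ge0 ?(ltW (charlier_x_prod_gt0 _))//.
by rewrite mulr_ge0 ?(ltW (charlier_x_prod_gt0 _))// mulr_ge0// charlier_D_ge0.
Qed.

Lemma first_run_ac_le n r : first_run_ac n r <= first_run n r.
Proof.
rewrite /first_run_ac /first_run.
rewrite ler_wpM2r ?invr_ge0 ?(ltW (charlier_x_prod_gt0 _))//.
rewrite ler_wpM2r ?(ltW (charlier_x_prod_gt0 _))// ler_wpM2l//.
exact: charlier_D_le_cloneB.
Qed.

Definition rising_ratio (n : nat) : R := x_prod x n / n`!%:R.

Lemma rising_ratio0 : rising_ratio 0 = 1.
Proof. by rewrite /rising_ratio x_prod0 divr1. Qed.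

Lemma rising_ratio_gt0 n : 0 < rising_ratio n.
Proof. by rewrite divr_gt0 ?charlier_x_prod_gt0 ?ltr0n ?fact_gt0. Qed.

Lemma rising_ratioS n :
  rising_ratio n.+1 = rising_ratio n * ((n%:R + rho) / n.+1%:R).
Proof.
rewrite /rising_ratio x_prodS charlier_xS factS natrM; field.
by rewrite nat1r !pnatr_eq0 -!lt0n fact_gt0.
Qed.

(** With n = m + r + 2 the product in [charlier_D] completes (m + 1)! to (n - 1)!, and all
    factorials cancel up to the factor 1/n. The bound on r keeps n - 2 - r from being truncated. *)
Lemma first_run_acE n r : (r < n.-1)%N ->
  first_run_ac n r =
  rho * (1 - rho) / n%:R * (rising_ratio (n - 2 - r) / rising_ratio n).
Proof.
move=> rn; rewrite /first_run_ac; set m := (n - 2 - r)%N.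
have -> : n = (m + r + 2)%N by rewrite /m; lia.
have P : (m.+1`!)%:R * \prod_(i < r) (m + i + 2)%:R = ((m + r).+1`!)%:R :> R.
  elim: (r) => [|k IH]; first by rewrite big_ord0 addn0 mulr1.
  rewrite big_ord_recr /= mulrA IH -natrM (addnS m k) [in RHS]factS mulnC.
  by congr (_ * _)%:R; lia.
rewrite /charlier_D /rising_ratio.
have -> : (m + r + 2)%N = (m + r).+2 by lia.
rewrite [(_.+2)`!]factS natrM -P factS natrM; field.
rewrite -!natrD nat1r !pnatr_eq0 -!lt0n fact_gt0 !gt_eqF ?charlier_x_prod_gt0//.
by apply: prodr_gt0 => i _; rewrite ltr0n addn2.
Qed.

(** Hockey-stick identity for the generalized binomial coefficients (rho)_i / i!. *)
Lemma sum_rising_ratio n :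
  \sum_(i < n) rising_ratio i = n%:R * rising_ratio n / rho.
Proof.
elim: n => [|n IH]; first by rewrite big_ord0 !mul0r.
rewrite big_ord_recr /= IH rising_ratioS; field.
by rewrite gt_eqF// nat1r pnatr_eq0.
Qed.

Lemma sum_first_run_ac n :
  \sum_(r < n.+1) first_run_ac n.+2 r = (1 - rho) * n.+1%:R / (n.+1%:R + rho).
Proof.
transitivity (\sum_(i < n.+1)
    rho * (1 - rho) / n.+2%:R / rising_ratio n.+2 * rising_ratio i).
  rewrite (reindex_inj rev_ord_inj); apply: eq_bigr => i _ /=.
  have ilt := ltn_ord i.
  rewrite first_run_acE /=; last by lia.
  have -> : (n.+2 - 2 - (n.+1 - i.+1) = i)%N by lia.
  by rewrite [X in _ * X]mulrC mulrA.
rewrite -mulr_sumr sum_rising_ratio [rising_ratio n.+2]rising_ratioS; field.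
have [h1 h2] := (rising_ratio_gt0 n.+1, rho_gt0).
by rewrite -natrD nat1r !gt_eqF ?ltr0n ?addr_gt0 ?ltr0n.
Qed.

(** The limit rho of this difference and the limit 1 - rho in [sum_first_run_ac] add up to 1, so no
    mass is left elsewhere. *)
Lemma first_run0 n :
  first_run n.+2 0 - first_run_ac n.+2 0 = rho * n.+1%:R / (n.+1%:R + rho).
Proof.
rewrite /first_run /first_run_ac subn0 subn2 /= cloneB0 /charlier_D big_ord0.
rewrite !x_prodS !charlier_xS /charlier_y mulr1 -natr1; field.
by rewrite !gt_eqF ?charlier_x_prod_gt0 ?ltr_wpDl// ?addr_ge0.
Qed.

(* [first_run - first_run_ac] is nonnegative and its total mass and its value at
   [0] are explicit, which bounds its mass away from [0]. *)
Lemma charlier_mean_approx n (G : seq letter -> R) (C : R) :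
  (forall w, weight w = n.+2 -> `|G w| <= C) ->
  `|charlier_mean n.+2 G - (rho * mean_after_run n.+2 G 0 +
      \sum_(r < n.+1) first_run_ac n.+2 r * mean_after_run n.+2 G r)|
    <= 2%:R * C / n.+1%:R.
Proof.
move=> GC; set c := mean_after_run n.+2 G.
have C0 : 0 <= C.
  apply: le_trans (normr_ge0 _) (GC (nseq n.+2 One) _).
  by elim: n.+2 => //= k; rewrite /weight /= => ->.
have cC r : (r < n.+1)%N -> `|c r| <= C.
  move=> rn; apply: charlier_mean_norm => u uw; apply: GC.
  move: uw; rewrite /weight map_cat sumn_cat /= map_nseq sumn_nseq /= => ->.
  by lia.
(* The constant function 1 gives the total mass: the mass of 1^(n+2) and the [first_run] weights sum
   to 1. *)
have := charlier_mean_cst n.+2 1; rewrite charlier_mean_run mulr1.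
under eq_bigr do rewrite /mean_after_run charlier_mean_cst mulr1.
rewrite charlier_mean_run -/c /=; set a := charlier_weight _ _.
have a0 : 0 <= a := charlier_weight_ge0 _ _.
have ga : `|G (nseq n.+2 One)| <= C.
  by apply: GC; rewrite /weight map_nseq sumn_nseq mul1n.
move: ga; set g := G _ => ga.
have /= := sum_first_run_ac n; have := first_run0 n.
rewrite !big_ord_recl /=.
set p0 := first_run _ 0; set q0 := first_run_ac _ 0.
set Q := \sum_(i < n) _; set S := \sum_(i < n) _.
move=> pq0 qQ pS.
(* The error splits into the word 1^(n+2), the deviation of the atom at r = 0 from rho, and the
   excess of [first_run] over [first_run_ac] for r >= 1. *)
rewrite (_ : _ - _ = a * g + (p0 - q0 - rho) * c 0%N + \sum_(i < n)
   (first_run n.+2 (lift ord0 i) - first_run_ac n.+2 (lift ord0 i)) *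
   c (lift ord0 i)); last first.
  under [X in _ = _ + X]eq_bigr do rewrite mulrBl.
  rewrite sumrB.
  set S1 := \sum_(i < n) _; set S2 := \sum_(i < n) _.
  by ring.
have d0 : 0 < n.+1%:R + rho by rewrite ltr_wpDl.
(* The three coefficients are nonnegative and sum exactly to rho (1 + rho) / (n + 1 + rho). *)
have hC : C * (a + (rho - (p0 - q0)) + (S - Q)) <= 2%:R * C / n.+1%:R.
  have -> : a + (rho - (p0 - q0)) + (S - Q) = rho * (1 + rho) / (n.+1%:R + rho).
    have -> : S - Q = 1 - (a + p0) - ((1 - rho) * n.+1%:R / (n.+1%:R + rho) - q0).
      by rewrite -qQ -pS; ring.
    have -> : q0 = p0 - rho * n.+1%:R / (n.+1%:R + rho) by rewrite -pq0; ring.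
    by field; rewrite nat1r gt_eqF.
  rewrite [2%:R * C]mulrC -!mulrA ler_wpM2l// mulrA ler_pM//.
  - by rewrite mulr_ge0 ?addr_ge0 ?ltW.
  - by rewrite invr_ge0 ltW.
  - have := rho_gt0; have := rho_lt1; nra.
  - by rewrite lef_pV2 ?posrE// lerDl ltW.
apply: le_trans hC.
apply: le_trans (ler_normD _ _) _; rewrite 2!mulrDr; apply: lerD.
  apply: le_trans (ler_normD _ _) _; apply: lerD.
    by rewrite normrM (ger0_norm a0) mulrC ler_wpM2r.
  rewrite normrM mulrC -normrN ler_pM//; first by rewrite normrN cC.
  rewrite distrC ger0_norm// subr_ge0 pq0.
  by rewrite ler_pdivrMr// ler_wpM2l ?ltW// ltrDl.
rewrite /S /Q -sumrB mulr_sumr; apply: le_trans (ler_norm_sum _ _ _) _.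
apply: ler_sum => i _; rewrite normrM mulrC.
rewrite [X in _ * X <= _]ger0_norm ?subr_ge0 ?first_run_ac_le// ler_wpM2r//.
  by rewrite subr_ge0 first_run_ac_le.
by rewrite cC// lift0 ltnS.
Qed.

End charlier.

(** * A tangent bound for powers, and limits of integer parts *)

(** Concavity of the power at z = 1, from Young's inequality for z^b and 1 with conjugate exponents
    1/b and 1/(1 - b). *)
Lemma powR_le_affine {R : realType} (b z : R) :
  0 < b < 1 -> 0 <= z -> z `^ b <= 1 + b * (z - 1).
Proof.
move=> /andP[b0 b1] z0.
have c0 : 0 < 1 - b by rewrite subr_gt0.
have := @conjugate_powR R (z `^ b) 1 b^-1 (1 - b)^-1 (powR_ge0 _ _) ler01.
rewrite !invr_gt0 !invrK => /(_ b0 c0).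
rewrite addrC subrK => /(_ erefl); rewrite mulr1 powR1 -powRrM divff ?gt_eqF//.
rewrite powRr1// mul1r => /le_trans; apply.
by rewrite le_eqVlt; apply/orP; left; apply/eqP; ring.
Qed.

Lemma truncn_lt {R : realType} n (a : R) : (0 < n)%N -> 0 <= a < 1 ->
  (Num.truncn (n%:R * a) < n)%N.
Proof.
move=> n0 /andP[a0 a1]; rewrite truncn_lt_nat ?mulr_ge0// gtr_pMr// ltr0n//.
Qed.

Section truncn_limits.
Context {R : realType} {a : R}.
Hypothesis a01 : 0 <= a < 1.
Let a_ge0 : 0 <= a. Proof. by case/andP: a01. Qed.
Let a_lt1 : a < 1. Proof. by case/andP: a01. Qed.
Local Notation r n := (Num.truncn (n.+2%:R * a)).

Let r_itv n : (r n)%:R <= n.+2%:R * a < (r n).+1%:R.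
Proof. by rewrite truncn_itv// mulr_ge0. Qed.

Lemma cvg_truncn_remainder : (n - r n)%N @[n --> \oo] --> \oo.
Proof.
have K (M r n : R) : M + 2 <= n * (1 - a) -> r <= (n + 1 + 1) * a -> M + r <= n.
  by have := a_lt1; lra.
apply/cvgnyPge => M; near=> n.
have : (M + 2)%:R / (1 - a) <= n%:R.
  by near: n; exact: nbhs_infty_ger.
rewrite ler_pdivrMr ?subr_gt0// => H; have /andP[r1 _] := r_itv n.
suff: (M + r n <= n)%N by lia.
rewrite -(ler_nat R) natrD; move: H r1.
by rewrite natrD -[n.+2%:R]natr1 -[n.+1%:R]natr1; exact: K.
Unshelve. all: by end_near. Qed.

Lemma near_truncn_lt : \forall n \near \oo, (r n < n.+1)%N.
Proof.
have /cvgnyPgt/(_ 0%N) := cvg_truncn_remainder.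
by apply: filterS => n; lia.
Qed.

Lemma cvg_truncn_ratio (s : nat) :
  (r n)%:R / (n.+2 + s)%:R @[n --> \oo] --> a.
Proof.
have hn : (n.+1%:R : R)^-1 @[n --> \oo] --> (0 : R) by exact: cvg_harmonic.
(* The integer part loses less than 1 and the shift of the denominator at most s a <= s, which
   accounts for s + 1. *)
apply: (@squeeze_cvgr _ _ _ _ (fun n => a - (s + 1)%:R * n.+1%:R^-1)
                              (fun n => a)); last 2 first.
- by rewrite -[X in _ --> X]subr0 -[X in _ - X](mulr0 (s + 1)%:R);
    apply: cvgB; [exact: cvg_cst|apply: cvgM; [exact: cvg_cst|exact: hn]].
- exact: cvg_cst.
apply: nearW => n; have /andP[r1 r2] := r_itv n.
have d0 : 0 < (n.+2 + s)%:R :> R by rewrite ltr0n.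
have n0 : 0 < n.+1%:R :> R by rewrite ltr0n.
apply/andP; split.
  rewrite ler_pdivlMr// mulrBl.
  have : (s + 1)%:R <= (s + 1)%:R / n.+1%:R * (n.+2 + s)%:R :> R.
    rewrite -mulrA ler_peMr// mulrC ler_pdivlMr// mul1r ler_nat; lia.
  move: r2; rewrite natrD -[(r n).+1%:R]natr1 natrD; have : 0 <= s%:R :> R by [].
  move: a_ge0 a_lt1; set z := _ / _ * _; nra.
rewrite ler_pdivrMr// (le_trans r1)// mulrC ler_wpM2l// ler_nat; lia.
Qed.

End truncn_limits.

(** * Asymptotics of the rescaled first-run weights *)

Section rising_ratio_asymptotics.
Context {R : realType}.
Variable rho : R.
Hypothesis rho01 : 0 < rho < 1.
Let rho_gt0 : 0 < rho. Proof. by case/andP: rho01. Qed.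
Let rho_lt1 : rho < 1. Proof. by case/andP: rho01. Qed.
Let beta01 : 0 < 1 - rho < 1.
Proof. by rewrite subr_gt0 rho_lt1 gtrBl rho_gt0. Qed.

Local Notation h := (rising_ratio rho).
Let h_gt0 n : 0 < h n. Proof. exact: rising_ratio_gt0. Qed.
Let h_ge0 n : 0 <= h n. Proof. exact: ltW. Qed.

(** The power (n + 1)^(1 - rho) compensates the decay of (rho)_n / n!. Quotients of these values
    enter the weights, so the limit cancels once it is known to exist and to be positive. *)
Definition scaled_ratio (n : nat) : R := h n * n.+1%:R `^ (1 - rho).

(** Serves twice: with n + 2, n + 1 for the decrease of h(n) (n + 1)^(1 - rho), and with n + 1, n +
    2 for the increase of h(n) n^(1 - rho). *)
Let bern (n m : nat) : (0 < m)%N ->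
  n%:R `^ (1 - rho) <= m%:R `^ (1 - rho) * (1 + (1 - rho) * (n%:R / m%:R - 1)).
Proof.
move=> m0; have mR : 0 < m%:R :> R by rewrite ltr0n.
have nm : 0 <= n%:R / m%:R :> R by rewrite divr_ge0.
apply: le_trans (ler_wpM2l (powR_ge0 _ _) (powR_le_affine _ _ beta01 nm)).
by rewrite -powRM ?ler0n// mulrCA divff ?mulr1// gt_eqF.
Qed.

Lemma scaled_ratio_nonincreasing : nonincreasing_seq scaled_ratio.
Proof.
apply/nonincreasing_seqP => n; rewrite /scaled_ratio rising_ratioS -mulrA.
rewrite ler_wpM2l//.
have n0 : 0 < n.+1%:R :> R by rewrite ltr0n.
have d0 : 0 <= (n%:R + rho) / n.+1%:R by rewrite divr_ge0 ?addr_ge0 ?(ltW rho_gt0).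
apply: le_trans (ler_wpM2l d0 (bern n.+2 n.+1 isT)) _.
rewrite mulrCA ler_piMr ?powR_ge0//.
rewrite [X in X <= _](_ : _ = 1 - ((1 - rho) / n.+1%:R) ^+ 2); last first.
  by field; rewrite nat1r gt_eqF.
by rewrite gerBl sqr_ge0.
Qed.

Lemma scaled_ratio_le1 n : scaled_ratio n <= 1.
Proof.
have := scaled_ratio_nonincreasing _ _ (leq0n n) => /le_trans; apply.
by rewrite /scaled_ratio rising_ratio0 powR1 mul1r.
Qed.

(** The sequence h(n) n^(1 - rho) is nondecreasing from its value h(1) = rho at n = 1 and stays
    below [scaled_ratio]. *)
Lemma scaled_ratio_ge n : rho <= scaled_ratio n.
Proof.
case: n => [|n].
  by rewrite /scaled_ratio rising_ratio0 powR1 mul1r ltW.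
have : rho <= h n.+1 * n.+1%:R `^ (1 - rho).
  elim: n => [|n IH].
    by rewrite rising_ratioS rising_ratio0 powR1 add0r divr1 mul1r mulr1.
  apply: le_trans IH _; rewrite [X in _ <= X * _]rising_ratioS -[leRHS]mulrA.
  rewrite ler_wpM2l//.
  apply: le_trans (bern n.+1 n.+2 isT) _; rewrite mulrC ler_wpM2r ?powR_ge0//.
  have n0 : 0 < n.+2%:R :> R by rewrite ltr0n.
  rewrite le_eqVlt; apply/orP; left; apply/eqP.
  by field; rewrite -natrD gt_eqF.
move=> /le_trans; apply; rewrite /scaled_ratio ler_wpM2l//.
rewrite ge0_ler_powR ?nnegrE ?ler0n ?ler_nat//.
by rewrite ltW//; case/andP: beta01.
Qed.

Lemma scaled_ratio_gt0 n : 0 < scaled_ratio n.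
Proof. exact: lt_le_trans rho_gt0 (scaled_ratio_ge n). Qed.

Lemma is_cvg_scaled_ratio : cvgn scaled_ratio.
Proof.
apply: nonincreasing_is_cvgn; first exact: scaled_ratio_nonincreasing.
by exists rho => _ [n _ <-]; exact: scaled_ratio_ge.
Qed.

Lemma lim_scaled_ratio_gt0 : 0 < limn scaled_ratio.
Proof.
apply: lt_le_trans rho_gt0 _; apply: limr_ge; first exact: is_cvg_scaled_ratio.
by apply: nearW => n; exact: scaled_ratio_ge.
Qed.

Lemma rising_ratio_div m n : h m / h n =
  scaled_ratio m / scaled_ratio n * (n.+1%:R / m.+1%:R) `^ (1 - rho).
Proof.
rewrite /scaled_ratio powRM ?invr_ge0 ?ler0n//.
rewrite -[_^-1 in X in _ * (_ * X)]powR_inv1 ?ler0n// powRAC powR_inv1 ?powR_ge0//.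
have p0 k : 0 < k.+1%:R `^ (1 - rho) by rewrite powR_gt0.
by field; rewrite !gt_eqF.
Qed.

Lemma first_run_ac_density n r : (r < n.+1)%N ->
  n.+2%:R * first_run_ac rho n.+2 r = rho * (1 - rho) *
    (scaled_ratio (n - r) / scaled_ratio n.+2) *
    (n.+3%:R / (n - r).+1%:R) `^ (1 - rho).
Proof.
move=> rn; rewrite first_run_acE//= subn2 /= rising_ratio_div.
by field; rewrite gt_eqF ?scaled_ratio_gt0//= -natrD pnatr_eq0.
Qed.

Lemma first_run_ac_density_le n (a : R) : 0 <= a < 1 ->
  let r := Num.truncn (n.+2%:R * a) in (r < n.+1)%N ->
  n.+2%:R * first_run_ac rho n.+2 r <= 4%:R * (1 - rho) / rho * eta_density rho a.
Proof.
move=> a01 r rn; have /andP[a0 a1] := a01.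
have n0 : 0 < n.+2%:R :> R by rewrite ltr0n.
have /andP[ra _] : r%:R <= n.+2%:R * a < r.+1%:R.
  by rewrite truncn_itv// mulr_ge0.
rewrite first_run_ac_density//.
have [a1' s0] : 0 < 1 - a /\ 0 <= 1 - rho by rewrite !subr_gt0 subr_ge0 ltW.
have s1 := scaled_ratio_le1 (n - r); have s2 := scaled_ratio_ge n.+2.
(* From r <= (n + 2) a follows (n + 2) (1 - a) <= (n - r) + 2; since n - r + 1 >= 1, the factor 4
   absorbs the rounding for every a < 1. *)
have H : n.+3%:R / (n - r).+1%:R <= 4%:R * (1 - a)^-1.
  rewrite ler_pdivrMr ?ltr0n// -mulrA mulrCA mulrC -ler_pdivrMr ?invr_gt0// invrK.
  have rn' : (r <= n)%N by rewrite -ltnS.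
  rewrite -[(n - r).+1%:R]natr1 natrB//.
  have : r%:R <= n%:R :> R by rewrite ler_nat.
  have := ra; rewrite -[n.+3%:R]natr1 -[n.+2%:R]natr1 -[n.+1%:R]natr1.
  have : 0 <= n%:R * (1 - a) by rewrite mulr_ge0 ?(ltW a1').
  lra.
have H2 : (n.+3%:R / (n - r).+1%:R) `^ (1 - rho) <= 4%:R * (1 - a) `^ (rho - 1).
  apply: (@le_trans _ _ ((4%:R * (1 - a)^-1) `^ (1 - rho))).
    by apply: ge0_ler_powR; rewrite ?nnegrE ?divr_ge0 ?mulr_ge0 ?invr_ge0 ?(ltW a1').
  rewrite powRM ?invr_ge0// ?(ltW a1')// -powR_inv1 ?(ltW a1')// -powRrM mulN1r opprB.
  rewrite ler_wpM2r ?powR_ge0//.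
  by apply: ler1_powR; [rewrite ler1n|rewrite gerBl ltW].
have H3 : scaled_ratio (n - r) / scaled_ratio n.+2 <= rho^-1.
  rewrite -[leRHS]mul1r.
  apply: ler_pM; rewrite ?invr_ge0 ?(ltW (scaled_ratio_gt0 _))//.
  by rewrite lef_pV2 ?posrE ?scaled_ratio_gt0.
rewrite /eta_density.
rewrite [leRHS](_ : _ = rho * (1 - rho) * rho^-1 * (4%:R * (1 - a) `^ (rho - 1))); last first.
  by field; rewrite gt_eqF.
apply: ler_pM => //; last by rewrite ler_wpM2l// mulr_ge0 ?(ltW rho_gt0).
apply: mulr_ge0; first by rewrite mulr_ge0 ?(ltW rho_gt0).
by rewrite divr_ge0 ?(ltW (scaled_ratio_gt0 _)).
Qed.

Lemma cvg_first_run_ac_density (a : R) : 0 <= a < 1 ->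
  n.+2%:R * first_run_ac rho n.+2 (Num.truncn (n.+2%:R * a)) @[n --> \oo] -->
  (1 - rho) * eta_density rho a.
Proof.
move=> a01; have /andP[a_ge0 a_lt1] := a01.
pose L := limn scaled_ratio.
have L0 : L != 0 by rewrite gt_eqF// lim_scaled_ratio_gt0.
have a1' : 0 < 1 - a by rewrite subr_gt0.
(* The quotient L / L is the limit of the two [scaled_ratio] factors. *)
have -> : (1 - rho) * eta_density rho a =
    rho * (1 - rho) * (L / L) * ((1 - a)^-1) `^ (1 - rho).
  rewrite divff// /eta_density -powR_inv1 ?(ltW a1')// -powRrM mulN1r opprB; ring.
apply: (@cvg_trans _ (rho * (1 - rho) *
    (scaled_ratio (n - Num.truncn (n.+2%:R * a)) / scaled_ratio n.+2) *
    (n.+3%:R / (n - Num.truncn (n.+2%:R * a)).+1%:R) `^ (1 - rho) @[n --> \oo])).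
  apply: near_eq_cvg; have := near_truncn_lt a01; apply: filterS => n rn.
  by rewrite first_run_ac_density.
apply: cvgM.
  apply: cvgM; first exact: cvg_cst.
  apply: cvgM.
    exact: (cvg_comp _ _ (cvg_truncn_remainder a01) is_cvg_scaled_ratio).
  apply: cvgV => //.
  by have : scaled_ratio @ \oo --> L := is_cvg_scaled_ratio; rewrite -2!cvg_shiftS.
have cpow : {for (1 - a)^-1, continuous (fun z : R => z `^ (1 - rho))}.
  apply: differentiable_continuous; apply/derivable1_diffP.
  have v0 : 0 < (1 - a)^-1 by rewrite invr_gt0.
  by have [] := is_derive1_powR (1 - rho) v0.
suff cv : n.+3%:R / (n - Num.truncn (n.+2%:R * a)).+1%:R @[n --> \oo] --> (1 - a)^-1.
  exact: (cvg_comp _ _ cv cpow).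
apply: (@cvg_trans _ (((n - Num.truncn (n.+2%:R * a)).+1%:R / n.+3%:R)^-1 @[n --> \oo])).
  by apply: near_eq_cvg; apply: nearW => n; rewrite invf_div.
apply: cvgV; first by rewrite gt_eqF.
(* Here n - r + 1 = (n + 3) - 2 - r, and the denominator n + 3 is the case s = 1 of
   [cvg_truncn_ratio]. *)
apply: (@cvg_trans _ ((1 - 2%:R * n.+3%:R^-1 -
    (Num.truncn (n.+2%:R * a))%:R / (n.+2 + 1)%:R) @[n --> \oo])).
  apply: near_eq_cvg; have := near_truncn_lt a01; apply: filterS => n rn.
  rewrite -[(n - Num.truncn (n.+2%:R * a)).+1%:R]natr1 natrB; last by rewrite -ltnS.
  rewrite addn1; field.
  by rewrite -natrD gt_eqF.
apply: cvgB; last exact: cvg_truncn_ratio a01 _.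
rewrite -[X in _ --> X]subr0 -[X in _ - X](mulr0 2%:R).
apply: cvgB; first exact: cvg_cst.
apply: cvgM; first exact: cvg_cst.
by have := @cvg_harmonic R; rewrite -2!cvg_shiftS.
Qed.

End rising_ratio_asymptotics.

(** * Sums over the first run as integrals of step functions, and their limit *)

Section step_function.
Context {R : realType}.
Local Notation mu := (@lebesgue_measure R).
Variables (n : nat) (v : nat -> R).
Let cell (r : nat) : set R := `[r%:R / n.+1%:R, r.+1%:R / n.+1%:R[.

Lemma step_functionE (a : R) : 0 <= a < 1 ->
  v (Num.truncn (n.+1%:R * a)) = \sum_(r < n.+1) v r * \1_(cell r) a.
Proof.
move=> a01; have rn := truncn_lt n.+1 a isT a01.
have cellE r : \1_(cell r) a = (Num.truncn (n.+1%:R * a) == r)%:R :> R.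
  rewrite indicE; congr (nat_of_bool _)%:R.
  have na : 0 <= n.+1%:R * a by case/andP: a01 => a0 _; rewrite mulr_ge0.
  rewrite truncn_eq// mulrC -ler_pdivrMr// -ltr_pdivlMr//.
  by apply/idP/idP; rewrite inE /cell /= in_itv.
rewrite (bigD1 (Ordinal rn)) //= cellE eqxx mulr1 big1 ?addr0// => i ni.
rewrite cellE (_ : (_ == _) = false) ?mulr0//.
by apply: contra_neqF ni => /eqP ri; apply/val_inj.
Qed.

Lemma measurable_step_function :
  measurable_fun `[(0 : R), 1[ (fun a : R => v (Num.truncn (n.+1%:R * a))).
Proof.
apply: (@eq_measurable_fun _ _ _ _ _ (fun a : R => \sum_(r < n.+1) v r * \1_(cell r) a)).
  by move=> a; rewrite inE /= in_itv/= => a01; rewrite step_functionE.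
apply: measurable_sum => r; apply: measurable_funM => //.
by apply: measurable_indic; exact: measurable_itv.
Qed.

Lemma integral_step_function :
  (\int[mu]_(a in `[0%R, 1%R[) (v (Num.truncn (n.+1%:R * a)))%:E =
   ((\sum_(r < n.+1) v r) / n.+1%:R)%:E)%E.
Proof.
have n0 : 0 < n.+1%:R :> R by rewrite ltr0n.
rewrite (eq_integral (fun a : measurableTypeR R =>
    \sum_(r < n.+1) ((v r)%:E * (\1_(cell r) a)%:E))%E); last first.
  move=> a; rewrite inE /= in_itv/= => a01; rewrite step_functionE// -sumEFin.
  by apply: eq_bigr => r _; rewrite EFinM.
have icell r : mu.-integrable `[(0 : R), 1[ (fun a => (\1_(cell r) a)%:E).
  apply: (integrableS measurableT) => //.
  exact: integrable_indic_itv.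
rewrite integral_sum//; last first.
  by move=> r; apply: integrableZl => //; exact: icell.
rewrite mulr_suml -sumEFin; apply: eq_bigr => r _.
rewrite integralZl//.
rewrite integral_indic//; last exact: measurable_itv.
rewrite setIidl; last first.
  move=> a; rewrite /cell /= !in_itv/= => /andP[ra ar].
  rewrite (le_trans _ ra) ?divr_ge0//= (lt_le_trans ar)//.
  by rewrite ler_pdivrMr// mul1r ler_nat.
rewrite [X in (_ * X)%E](_ : _ = (n.+1%:R^-1)%:E) ?EFinM//.
apply: etrans; first exact: lebesgue_measure_itv.
rewrite /= lte_fin ltr_pM2r ?invr_gt0// ltr_nat ltnSn.
by rewrite -EFinB -mulrBl -natrB// subSnn mul1r.
Qed.

End step_function.

Section first_run_limit.
Context {R : realType}.
Local Notation mu := (@lebesgue_measure R).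
Variable rho : R.
Hypothesis rho01 : 0 < rho < 1.
Let rho_gt0 : 0 < rho. Proof. by case/andP: rho01. Qed.
Let rho_lt1 : rho < 1. Proof. by case/andP: rho01. Qed.

Lemma integrable_eta_density :
  mu.-integrable `[(0 : R), 1[ (fun a => (eta_density rho a)%:E).
Proof.
apply/integrableP; split.
  by apply/measurable_funTS/measurable_EFinP; exact: measurable_eta_density.
under eq_integral => a _ do
  rewrite gee0_abs ?lee_fin ?(eta_density_ge0 rho01)//.
rewrite integral_itv_bndo_bndc ?integral_eta_density ?ltry//.
by apply/measurable_funTS/measurable_EFinP; exact: measurable_eta_density.
Qed.

(** The sum is the integral over [0, 1) of a step function with cells of length 1/(n + 2), so
    dominated convergence applies with a multiple of [eta_density] as bound. *)
Lemma cvg_sum_first_run_ac (c : nat -> nat -> R) (Psi : R -> R) (C : R) :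
  (forall n r, (r < n.+1)%N -> `|c n r| <= C) ->
  (forall a, 0 <= a < 1 ->
    c n (Num.truncn (n.+2%:R * a)) @[n --> \oo] --> Psi a) ->
  (\sum_(r < n.+1) first_run_ac rho n.+2 r * c n r)%:E @[n --> \oo] -->
  (\int[mu]_(a in `[0%R, 1%R[) ((1 - rho) * eta_density rho a * Psi a)%:E)%E.
Proof.
move=> cC cPsi.
have C0 : 0 <= C by apply: le_trans (cC 0%N 0%N isT).
(* There are n + 2 cells but only n + 1 possible lengths r; the last cell gets the value 0. *)
pose v n r : R :=
  if (r < n.+1)%N then n.+2%:R * first_run_ac rho n.+2 r * c n r else 0.
pose F n (a : R) := v n (Num.truncn (n.+2%:R * a)).
have FPsi a : 0 <= a < 1 ->
    F n a @[n --> \oo] --> (1 - rho) * eta_density rho a * Psi a.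
  move=> a01.
  apply: (@cvg_trans _ (n.+2%:R * first_run_ac rho n.+2 (Num.truncn (n.+2%:R * a)) *
    c n (Num.truncn (n.+2%:R * a)) @[n --> \oo])).
    apply: near_eq_cvg; have := near_truncn_lt a01; apply: filterS => n rn.
    by rewrite /F /v rn.
  apply: cvgM; last exact: cPsi.
  exact: cvg_first_run_ac_density.
have mF n : measurable_fun `[(0 : R), 1[ (F n) by exact: measurable_step_function.
have iK : mu.-integrable `[(0 : R), 1[ (fun a =>
    (4%:R * (1 - rho) / rho * C)%:E * (eta_density rho a)%:E)%E.
  by apply: integrableZl; [exact: measurable_itv|exact: integrable_eta_density].
have dom n a : 0 <= a < 1 ->
    `|F n a| <= 4%:R * (1 - rho) / rho * C * eta_density rho a.
  move=> a01; rewrite /F /v; case: ifPn => [rn|_]; last first.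
    rewrite normr0 mulr_ge0 ?(eta_density_ge0 rho01)//.
    by rewrite mulr_ge0// divr_ge0 ?(ltW rho_gt0)// mulr_ge0// subr_ge0 ltW.
  have q0 : 0 <= n.+2%:R * first_run_ac rho n.+2 (Num.truncn (n.+2%:R * a)).
    by apply: mulr_ge0 => //; exact: first_run_ac_ge0.
  rewrite normrM (ger0_norm q0) [leRHS]mulrAC; apply: ler_pM => //; last exact: cC.
  exact: (first_run_ac_density_le _ rho01 n a a01 rn).
have [] := @dominated_convergence _ _ R mu `[(0 : R), 1[ (measurable_itv _)
  (fun n a => (F n a)%:E) (fun a => ((1 - rho) * eta_density rho a * Psi a)%:E)
  (fun a => (4%:R * (1 - rho) / rho * C)%:E * (eta_density rho a)%:E)%E.
- by move=> n; apply/measurable_EFinP; exact: mF.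
- apply/measurable_EFinP; apply: (measurable_fun_cvg mF) => a.
  by rewrite /= in_itv/=; exact: FPsi.
- apply: aeW => a; rewrite /= in_itv/= => a01.
  by apply: cvg_EFin; [exact: nearW|exact: FPsi].
- by [].
- apply: aeW => a n; rewrite /= in_itv/= => a01.
  by rewrite lee_fin dom.
move=> _ _; apply: cvg_trans; apply: near_eq_cvg; apply: nearW => n.
apply: (etrans (integral_step_function n.+1 (v n))).
rewrite big_ord_recr /= {2}/v ltnn addr0 mulr_suml.
congr (_%:E); apply: eq_bigr => r _; rewrite /v ltn_ord; field.
by rewrite -natrD pnatr_eq0.
Qed.

End first_run_limit.

(** * Integration against a measure with density and against [eta_law] *)

Section integral_density.
Context d (T : measurableType d) (R : realType).
Variables (mu nu : {measure set T -> \bar R}) (g : T -> R).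
Local Open Scope ereal_scope.
Hypothesis g_ge0 : forall x, (0 <= g x)%R.
Hypothesis mg : measurable_fun setT g.
Let mEg : measurable_fun setT (EFin \o g). Proof. exact/measurable_EFinP. Qed.
Hypothesis nuE : forall A, measurable A -> nu A = \int[mu]_(x in A) (g x)%:E.

Let integral_density_indic (E : set T) : measurable E ->
  \int[nu]_x (\1_E x)%:E = \int[mu]_x ((\1_E x)%:E * (g x)%:E).
Proof.
move=> mE; rewrite integral_indic// setIT nuE// integral_mkcond.
apply: eq_integral => x _; rewrite patchE indicE.
by case: (x \in E); rewrite ?mul1e ?mul0e.
Qed.

Import HBNNSimple.

Let integral_density_nnsfun (f : {nnsfun T >-> R}) :
  \int[nu]_x (f x)%:E = \int[mu]_x ((f x)%:E * (g x)%:E).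
Proof.
under [LHS]eq_integral do rewrite fimfunE -fsumEFin//.
rewrite [LHS]ge0_integral_fsum//; last 2 first.
  - by move=> r; exact/measurable_EFinP/measurableT_comp.
  - by move=> n x _; rewrite EFinM nnfun_muleindic_ge0.
under [RHS]eq_integral.
  move=> x xD; rewrite fimfunE -fsumEFin// ge0_mule_fsuml; last first.
    by move=> r; rewrite EFinM nnfun_muleindic_ge0.
  over.
rewrite [RHS]ge0_integral_fsum//; last 2 first.
  - move=> r; apply: emeasurable_funM => //.
    exact/measurable_EFinP/measurableT_comp.
  - by move=> n x _; rewrite EFinM mule_ge0 ?nnfun_muleindic_ge0 ?lee_fin.
apply: eq_fsbigr => r; rewrite inE => -[z _ fzr].
have r0 : (0 <= r)%R by rewrite -fzr.
have mr : measurable (f @^-1` [set r]) by [].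
under [RHS]eq_integral do rewrite EFinM -muleA.
rewrite [RHS]ge0_integralZl//.
- by rewrite integralZl_indic_nnsfun// integral_density_indic.
- apply: emeasurable_funM => //.
  exact/measurable_EFinP/measurable_indic.
- by move=> x _; rewrite mule_ge0// lee_fin.
Qed.

(** Monotone convergence along simple functions increasing to f extends the identity, which holds
    for indicators by [nuE]. *)
Lemma ge0_integral_density (f : T -> R) :
  measurable_fun setT f -> (forall x, 0 <= f x)%R ->
  \int[nu]_x (f x)%:E = \int[mu]_x ((f x)%:E * (g x)%:E).
Proof.
move=> /measurable_EFinP mf f0; pose f_ := nnsfun_approx measurableT mf.
have cf x : (f_ n x)%:E @[n --> \oo] --> (f x)%:E.
  by apply: cvg_nnsfun_approx => // y _; rewrite lee_fin.
have ndf x : {homo (fun n => (f_ n x)%:E) : m n / (m <= n)%N >-> m <= n}.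
  by move=> m n mn; rewrite lee_fin; exact/lefP/nd_nnsfun_approx.
transitivity (limn (fun n => \int[nu]_x (f_ n x)%:E)).
  rewrite -monotone_convergence//=.
  - by apply: eq_integral => x _; apply/esym/cvg_lim => //; exact: cf.
  - by move=> n; exact/measurable_EFinP/measurable_funTS.
  - by move=> n x _; rewrite lee_fin.
under eq_fun do rewrite integral_density_nnsfun.
rewrite -monotone_convergence//=.
- apply: eq_integral => x _; apply/cvg_lim => //.
  by apply: cvgeM; [exact: mule_def_fin|exact: cf|exact: cvg_cst].
- move=> n; apply: emeasurable_funM => //.
  exact/measurable_EFinP/measurable_funTS.
- by move=> n x _; rewrite mule_ge0// lee_fin.
- by move=> x _ m n mn; rewrite lee_wpmul2r ?lee_fin//; exact: ndf.
Qed.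

End integral_density.

Section eta_law_integral.
Context {R : realType}.
Local Notation mu := (@lebesgue_measure R).
Variable rho : R.
Hypothesis rho01 : 0 < rho < 1.
Let rho_ge0 : 0 <= rho. Proof. by case/andP: rho01 => /ltW. Qed.
Let rhoC_ge0 : 0 <= 1 - rho. Proof. by rewrite subr_ge0; case/andP: rho01 => _ /ltW. Qed.

Let ac : {measure set (measurableTypeR R) -> \bar R} :=
  Defs_eta_ac__canonical__measure_function_Measure rho01.

Lemma ge0_integral_eta_law (Psi : R -> R) :
  measurable_fun setT Psi -> (forall a, 0 <= Psi a) ->
  (\int[eta_law rho01]_a (Psi a)%:E = (rho * Psi 0%R)%:E +
   \int[mu]_(a in `[0%R, 1%R[) ((1 - rho) * eta_density rho a * Psi a)%:E)%E.
Proof.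
move=> mPsi Psi0.
have mEPsi : measurable_fun setT (EFin \o Psi) by exact/measurable_EFinP.
have meta : measurable_fun setT (eta_density rho) := measurable_eta_density rho.
rewrite (eq_measure_integral (measure_add
  (mscale (NngNum rho_ge0) \d_(0 : measurableTypeR R)) (mscale (NngNum rhoC_ge0) ac)));
  last first.
  by move=> A mA _; apply: esym; exact: measure_addE.
rewrite ge0_integral_measure_add//; last by move=> a _; rewrite lee_fin.
rewrite !ge0_integral_mscale//; try by move=> a _; rewrite lee_fin.
rewrite integral_dirac//= diracT mul1e EFinM; congr (_ + _)%E.
(* The restriction to [0, 1] moves from the domain of integration into the density, which has to
   live on the whole line. *)
pose g a : R := eta_density rho a * \1_`[0, 1] a.
have mg : measurable_fun setT g.
  by apply: measurable_funM => //; apply: measurable_indic; exact: measurable_itv.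
have eta0 := eta_density_ge0 rho01.
rewrite (@ge0_integral_density _ _ _ mu ac g)//.
- rewrite -ge0_integralZl//; last 2 first.
  + by apply: emeasurable_funM; exact/measurable_EFinP.
  + by move=> a _; rewrite lee_fin mulr_ge0// mulr_ge0// indicE.
  rewrite integral_itv_bndo_bndc; last first.
    apply/measurable_funTS/measurable_EFinP; apply: measurable_funM => //.
    exact: measurable_funM.
  rewrite [RHS]integral_mkcond; apply: eq_integral => a _.
  rewrite patchE /g indicE; case: (a \in _); rewrite /= ?mulr0 ?mule0//.
  by rewrite mulr1 -!EFinM; congr (_%:E); ring.
- by move=> a; rewrite mulr_ge0// indicE.
- move=> A mA; rewrite /ac /= /eta_ac integral_mkcondr.
  apply: eq_integral => a _; rewrite patchE /g indicE.
  by case: (a \in _); rewrite /= ?mulr1 ?mulr0.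
Qed.

End eta_law_integral.

(** * Measurability of continuous functions of a tuple *)

Section measurable_row.
Context {R : realType} {k : nat}.
Variable f : 'rV[R]_k -> R.
Hypothesis cf : continuous f.

Let grid (N : nat) (z : {ffun 'I_k -> int}) : 'rV[R]_k :=
  \row_j ((z j)%:~R / N.+1%:R).
Let cell (N : nat) (t : k.-tuple (measurableTypeR R)) : {ffun 'I_k -> int} :=
  [ffun j => Num.floor (N.+1%:R * tnth t j : R)].

Let measurable_grid N :
  measurable_fun setT (fun t : k.-tuple (measurableTypeR R) => f (grid N (cell N t))).
Proof.
have n0 : 0 < N.+1%:R :> R by rewrite ltr0n.
move=> _ Y mY; rewrite setTI.
rewrite (_ : _ @^-1` _ =
    \bigcup_(z in [set z | Y (f (grid N z))]) (cell N @^-1` [set z])).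
  rewrite bigcup_mkcond; apply: countable_bigcupT_measurable => [//|z].
  case: ifPn => // _.
  rewrite (_ : _ @^-1` _ = box (fun j : 'I_k =>
    `[((z j)%:~R / N.+1%:R : R), (z j + 1)%:~R / N.+1%:R[%classic)).
    by apply: measurable_box => j; exact: measurable_itv.
  have E (t : k.-tuple (measurableTypeR R)) j :
     (Num.floor (N.+1%:R * tnth t j : R) = z j) <->
     `[((z j)%:~R / N.+1%:R : R), (z j + 1)%:~R / N.+1%:R[%classic (tnth t j).
    rewrite /= in_itv /= ler_pdivrMr// ltr_pdivlMr// mulrC.
    by split=> [<-|]; [rewrite floor_itv|move/floor_def].
  apply/seteqP; split => t /=.
    by move=> /ffunP tz j; have := tz j; rewrite ffunE => /E.
  by move=> tz; apply/ffunP => j; rewrite ffunE; apply/E; exact: tz.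
apply/seteqP; split => t /=; first by move=> Yt; exists (cell N t).
by case=> z Yz ->.
Qed.

(** The sigma-algebra on tuples comes from the coordinates, not from the topology of row vectors.
    Rounding each coordinate down to a multiple of 1/(N + 1) gives functions constant on countably
    many boxes, which converge to f by continuity. *)
Lemma measurable_fun_row :
  measurable_fun setT (fun t : k.-tuple (measurableTypeR R) => f (\row_j tnth t j)).
Proof.
apply: (measurable_fun_cvg measurable_grid) => t _.
apply: (@cvg_comp _ _ _ (fun N => grid N (cell N t)) f \oo
  (nbhs (\row_j tnth t j : 'rV[R]_k))); last exact: cf.
apply/cvg_ballP => e e0; near=> N.
have n0 : 0 < N.+1%:R :> R by rewrite ltr0n.
split=> // i j; rewrite !mxE ffunE /ball /=.
have /andP[f1 f2] := floor_itv (N.+1%:R * tnth t j : R).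
rewrite ger0_norm; last by rewrite subr_ge0 ler_pdivrMr// [leRHS]mulrC.
apply: (@le_lt_trans _ _ N.+1%:R^-1).
  rewrite -(ler_pM2l n0) mulrBr [X in _ - X]mulrCA !divff ?gt_eqF// mulr1.
  by rewrite lerBlDl; move: f2; rewrite intrD => /ltW.
near: N; exact: near_infty_natSinv_lt (PosNum e0).
Unshelve. all: by end_near. Qed.

End measurable_row.

(** * Row vectors with a prepended entry *)

Section cons_row.
Context {R : realType} {k : nat}.

Definition cons_row (a : R) (v : 'rV[R]_k) : 'rV[R]_k.+1 :=
  \row_j oapp (v ord0) a (unlift ord0 j).

Lemma ball_cons_row (a b e : R) (v w : 'rV[R]_k) :
  `|a - b| < e -> ball v e w -> ball (cons_row a v) e (cons_row b w).
Proof.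
move=> ab [e0 vw]; split=> // i j; rewrite !mxE.
by case: unliftP => [j' _|_] /=; [exact: vw|].
Qed.

Lemma cons_row_tuple (p : measurableTypeR R * k.-tuple (measurableTypeR R)) :
  \row_j tnth (tuple_cons p) j = cons_row p.1 (\row_j tnth p.2 j).
Proof.
case: p => a t; apply/rowP => j; rewrite !mxE; case: unliftP => [j' ->|->] /=.
  by rewrite tnthS mxE.
by rewrite tnth0.
Qed.

Lemma continuous_cons_row a : continuous (cons_row a).
Proof.
move=> v A /nbhs_ballP[e /= e0 eA]; apply/nbhs_ballP; exists e => //= w vw.
by apply/eA/ball_cons_row => //; rewrite subrr normr0.
Qed.

(** Uniformity in v matters because v will be the random row of remaining ratios, whose law changes
    with n. Continuity gives a threshold near each point of K, and compactness makes it common. *)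
Lemma cons_row_equicontinuous (f : 'rV[R]_k.+1 -> R) (K : set 'rV[R]_k)
    (u : nat -> R) (a : R) :
  continuous f -> compact K -> u n @[n --> \oo] --> a ->
  forall e, 0 < e -> \forall n \near \oo, forall v, K v ->
    `|f (cons_row (u n) v) - f (cons_row a v)| < e.
Proof.
move=> cf /compact_near_coveringP cK ua e e0.
apply: (cK nat \oo (fun n v => `|f (cons_row (u n) v) - f (cons_row a v)| < e)).
move=> x _.
have e2 : 0 < e / 2 by rewrite divr_gt0.
have /nbhs_ballP[d /= d0 fd] := cf _ _ (nbhsx_ballx (f (cons_row a x)) _ e2).
exists (ball x d, [set n | `|a - u n| < d]) => /=.
  split; first exact: nbhsx_ballx.
  by have /cvgrPdist_lt/(_ _ d0) := ua.
move=> [x' n] [/= xx' und].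
have f1 : ball (f (cons_row a x)) (e / 2) (f (cons_row (u n) x')).
  by apply: fd; exact: ball_cons_row.
have f2 : ball (f (cons_row a x)) (e / 2) (f (cons_row a x')).
  by apply: fd; apply: ball_cons_row => //; rewrite subrr normr0.
exact: ball_splitr f1 f2.
Qed.

End cons_row.

(** * Rows of run ratios and removal of the first run *)

Section ratio_row.
Context {R : realType}.

(** The base N of the denominators is decoupled from the weight of the word, since removing a first
    run and its 2 lowers the two by different amounts. *)
Definition ratio_row (k N : nat) (w : seq letter) : 'rV[R]_k :=
  \row_(j < k) run_ratio N w j.+1.

Lemma runs_first r u : runs (nseq r One ++ Two :: u) = r :: runs u.
Proof. by elim: r => //= r ->. Qed.

Lemma ratio_row_first k N r u : (r <= N)%N ->
  ratio_row k.+1 N (nseq r One ++ Two :: u) =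
  cons_row (r%:R / N%:R) (ratio_row k (N - r) u).
Proof.
move=> rN; apply/rowP => j; rewrite !mxE; case: unliftP => [j' ->|->] /=.
  rewrite mxE /run_ratio /run runs_first /= /bump /= add1n; congr (_ / _).
  rewrite big_nat_recl//= big_add1 /= natrB// opprD addrA; congr (_ - _).
  by rewrite big_add1.
by rewrite /run_ratio /run runs_first big_geq// subr0.
Qed.

Lemma sumn_runs w : (sumn (runs w) <= weight w)%N.
Proof.
elim: w => //= -[] w IH; rewrite /weight /= -/(weight w).
  by have := runs_nil w; move: IH; case: (runs w) => //= r s; lia.
lia.
Qed.

(** The runs sum to at most the weight, so each is at most what the earlier ones leave of N; a zero
    denominator gives 0. *)
Lemma ratio_row_itv k N w : (weight w <= N)%N ->
  forall j, `[0%R, 1%R]%classic (ratio_row k N w ord0 j).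
Proof.
move=> wN j; rewrite mxE /run_ratio /= in_itv /= -natr_sum.
have H s i : (\sum_(1 <= l < i.+1) nth 0 s l.-1 + nth 0 s i <= sumn s)%N.
  elim: s i => [|r s IH] i; first by rewrite big1 ?nth_nil// => l _; rewrite nth_nil.
  case: i => [|i]; first by rewrite big_geq//= leq_addr.
  rewrite big_nat_recl//= -addnA leq_add2l; apply: leq_trans (IH i).
  by rewrite leq_add2r big_add1 [leqRHS]big_add1.
have {}H := leq_trans (leq_trans (H (runs w) j) (sumn_runs w)) wN.
set S := (\sum_(_ <= _ < _) _)%N in H *.
rewrite -natrB; last by apply: leq_trans H; rewrite leq_addr.
rewrite divr_ge0//=; have [->|NS] := eqVneq (N - S)%N 0%N.
  by rewrite invr0 mulr0.
by rewrite ler_pdivrMr ?ltr0n ?lt0n// mul1r ler_nat /run /=; move: H; lia.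
Qed.

End ratio_row.

(** * Weak convergence by induction on the number of runs *)

Section convergence.
Context {R : realType}.
Variable rho : R.
Hypothesis rho01 : 0 < rho < 1.
Local Notation nu := (iid_law (eta_law rho01)).
Local Notation mean := (charlier_mean rho).

Lemma ge0_integral_iid_lawS k (f : 'rV[R]_k.+1 -> R) :
  continuous f -> (forall v, 0 <= f v) ->
  (\int[nu k.+1]_t (f (\row_j tnth t j))%:E =
   \int[eta_law rho01]_a \int[nu k]_t (f (cons_row a (\row_j tnth t j)))%:E)%E.
Proof.
move=> cf f0.
have mf : measurable_fun setT (fun t : k.+1.-tuple (measurableTypeR R) =>
    (f (\row_j tnth t j))%:E) by apply/measurable_EFinP; exact: measurable_fun_row.
transitivity (\int[(eta_law rho01 \x nu k)]_p (f (\row_j tnth (tuple_cons p) j))%:E)%E.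
  have E := ge0_integral_pushforward (@measurable_tuple_cons _ (measurableTypeR R) k)
    (eta_law rho01 \x nu k)%E measurableT mf (fun t _ => f0 _).
  exact: E.
under eq_integral => p _ do rewrite cons_row_tuple.
rewrite (fubini_tonelli1 (fun p : measurableTypeR R * k.-tuple (measurableTypeR R) =>
  (f (cons_row p.1 (\row_j tnth p.2 j)))%:E))//=.
  rewrite [X in measurable_fun _ X](_ : _ = (fun t : k.+1.-tuple (measurableTypeR R) =>
    (f (\row_j tnth t j))%:E) \o @tuple_cons _ _ k).
    by apply: measurableT_comp => //; exact: measurable_tuple_cons.
  by apply/funext => p /=; rewrite cons_row_tuple.
by move=> p; rewrite lee_fin.
Qed.

Lemma measurable_fun_cons_row k (f : 'rV[R]_k.+1 -> R) :
  continuous f -> (forall v, 0 <= f v) ->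
  measurable_fun setT (fun a : measurableTypeR R =>
    (\int[nu k]_t (f (cons_row a (\row_j tnth t j)))%:E)%E).
Proof.
move=> cf f0.
apply: (measurable_fun_fubini_tonelli_F
  (fun p : measurableTypeR R * k.-tuple (measurableTypeR R) =>
  (f (cons_row p.1 (\row_j tnth p.2 j)))%:E)).
  rewrite [X in measurable_fun _ X](_ : _ = (fun t : k.+1.-tuple (measurableTypeR R) =>
    (f (\row_j tnth t j))%:E) \o @tuple_cons _ _ k).
    apply: measurableT_comp => //.
    by apply/measurable_EFinP; exact: measurable_fun_row.
  by apply/funext => p /=; rewrite cons_row_tuple.
by move=> p; rewrite lee_fin.
Qed.

Lemma integral_iid_law_cst k (c : R) : (\int[nu k]_t c%:E = c%:E)%E.
Proof.
have /= -> := integral_cst (nu k) measurableT c%:E.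
by rewrite -[RHS]mule1; congr (_ * _)%E; exact: probability_setT.
Qed.

Lemma integral_bounded_fin k (f : k.-tuple (measurableTypeR R) -> R) C :
  measurable_fun setT f -> (forall t, 0 <= f t <= C) ->
  exists2 c : R, 0 <= c <= C & (\int[nu k]_t (f t)%:E = c%:E)%E.
Proof.
move=> mf fC.
have I0 : (0 <= \int[nu k]_t (f t)%:E)%E.
  by apply: integral_ge0 => t _; rewrite lee_fin; case/andP: (fC t).
have IC : (\int[nu k]_t (f t)%:E <= C%:E)%E.
  rewrite -(integral_iid_law_cst k C).
  apply: ge0_le_integral => //.
  - by move=> t _; rewrite lee_fin; case/andP: (fC t).
  - exact/measurable_EFinP.
  - by move=> t _; rewrite lee_fin; case/andP: (fC t).
move: I0 IC; case: (\int[nu k]_t (f t)%:E)%E => [c| |]; rewrite ?lee_fin.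
- by move=> c0 cC; exists c; rewrite ?c0.
- by rewrite leye_eq.
- by rewrite leeNy_eq.
Qed.

(* The shift [s] accounts for the letters 2 that separate the runs: removing
   the first run and the following 2 from a word of weight [n] leaves a word of
   weight [n - r - 2], whereas the denominators only drop to [n - r]. *)
Lemma cvg_charlier_mean k (f : 'rV[R]_k -> R) (C : R) (s : nat) :
  continuous f -> (forall v, 0 <= f v <= C) ->
  (mean n (fun w => f (ratio_row k (n + s) w)))%:E @[n --> \oo] -->
  (\int[nu k]_t (f (\row_j tnth t j))%:E)%E.
Proof.
elim: k f s => [|k IH] f s cf fC.
  have f0 v : f v = f 0 by congr f; apply/rowP => -[].
  under eq_fun do under eq_fun do rewrite f0.
  under eq_integral do rewrite f0.
  rewrite integral_iid_law_cst.
  under eq_fun do rewrite (charlier_mean_cst rho rho01).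
  exact: cvg_cst.
have f0 v : 0 <= f v by case/andP: (fC v).
have cfa a : continuous (fun v => f (cons_row a v)).
  by move=> v; apply: continuous_comp; [exact: continuous_cons_row|exact: cf].
have H a : exists c : R, 0 <= c <= C /\
    (\int[nu k]_t (f (cons_row a (\row_j tnth t j)))%:E = c%:E)%E.
  have [||c cC cE] := @integral_bounded_fin k
    (fun t => f (cons_row a (\row_j tnth t j))) C.
  - exact: measurable_fun_row (cfa a).
  - by move=> t; exact: fC.
  - by exists c.
(* [Psi a] is the limiting mean of f given that the first ratio is a; [Phi m a] below is its
   counterpart for a remainder of weight m. *)
have [Psi PsiP] := choice H.
have PsiE : (fun a => \int[nu k]_t (f (cons_row a (\row_j tnth t j)))%:E)%E =
    EFin \o Psi by apply/funext => a; have [] := PsiP a.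
have Psi0 a : 0 <= Psi a by have [/andP[]] := PsiP a.
have mPsi : measurable_fun setT Psi.
  by apply/measurable_EFinP; rewrite -PsiE; exact: measurable_fun_cons_row.
pose Phi m a := mean m (fun u => f (cons_row a (ratio_row k (m + (s + 2)) u))).
have PhiPsi a : Phi m a @[m --> \oo] --> Psi a.
  have := IH _ (s + 2)%N (cfa a) (fun v => fC _).
  by have [_ ->] := PsiP a; exact: fine_cvg.
(* The first ratio varies together with the weight of the remainder; as the other ratios stay in the
   compact cube, replacing it by its limit is uniform. *)
have PhiPhi (b : nat -> R) (m : nat -> nat) a : b n @[n --> \oo] --> a ->
    Phi (m n) (b n) - Phi (m n) a @[n --> \oo] --> 0.
  move=> ba; apply/cvgr0Pnorm_le => e e0.
  have cK : compact [set v : 'rV[R]_k | forall j, `[0%R, 1%R]%classic (v ord0 j)].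
    by apply: (@rV_compact R k (fun=> `[0%R, 1%R]%classic)) => j; exact: segment_compact.
  have := cons_row_equicontinuous f _ _ _ cf cK ba e e0.
  apply: filterS => n nP; rewrite /Phi -charlier_meanB.
  apply: (charlier_mean_norm _ rho01) => w wm; apply/ltW/nP.
  by apply: ratio_row_itv; rewrite wm leq_addr.
have E n r : (r <= n)%N ->
    mean_after_run rho n.+2 (fun w => f (ratio_row k.+1 (n.+2 + s) w)) r =
    Phi (n - r)%N (r%:R / (n.+2 + s)%:R).
  move=> rn; rewrite /mean_after_run /Phi subn2 /=; congr charlier_mean.
  apply/funext => u; rewrite ratio_row_first; last by lia.
  by congr (f (cons_row _ (ratio_row _ _ _))); lia.
pose c n r := Phi (n - r)%N (r%:R / (n.+2 + s)%:R).
have cPsi a : 0 <= a < 1 ->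
    c n (Num.truncn (n.+2%:R * a)) @[n --> \oo] --> Psi a.
  move=> a01; rewrite -[X in _ --> X]add0r.
  (* First r / (n + 2 + s) is replaced by a, then the weight n - r of the remainder tends to
     infinity. *)
  rewrite (_ : (fun n => _) = (fun n =>
    (c n (Num.truncn (n.+2%:R * a)) - Phi (n - Num.truncn (n.+2%:R * a))%N a) +
    Phi (n - Num.truncn (n.+2%:R * a))%N a)); last first.
    by apply/funext => n; rewrite subrK.
  apply: cvgD.
    exact: PhiPhi (cvg_truncn_ratio a01 s).
  exact: (cvg_comp _ _ (cvg_truncn_remainder a01) (PhiPsi a)).
have cC n r : `|c n r| <= C.
  apply: (charlier_mean_norm _ rho01) => w _.
  by rewrite ger0_norm//; case/andP: (fC (cons_row (r%:R / (n.+2 + s)%:R)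
    (ratio_row k (n - r + (s + 2)) w))).
rewrite ge0_integral_iid_lawS// PsiE.
rewrite ge0_integral_eta_law//.
rewrite -2!cvg_shiftS.
pose err n := mean n.+2 (fun w => f (ratio_row k.+1 (n.+2 + s) w)) -
  (rho * c n 0%N + \sum_(r < n.+1) first_run_ac rho n.+2 r * c n r).
have err0 : err n @[n --> \oo] --> 0.
  apply/cvgr0Pnorm_le => e e0; near=> n.
  have fG w : weight w = n.+2 -> `|f (ratio_row k.+1 (n.+2 + s) w)| <= C.
    by move=> _; rewrite ger0_norm//; case/andP: (fC (ratio_row k.+1 (n.+2 + s) w)).
  have := charlier_mean_approx _ rho01 n _ _ fG.
  rewrite E// (eq_bigr (fun r : 'I_n.+1 => first_run_ac rho n.+2 r * c n r)); last first.
    by move=> r _; rewrite E// -ltnS.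
  move=> /le_trans; apply.
  have nC : 2%:R * C / e <= n%:R by near: n; exact: nbhs_infty_ger.
  rewrite ler_pdivrMr ?ltr0n// [leRHS]mulrC -ler_pdivrMr// (le_trans nC)//.
  by rewrite ler_nat.
rewrite (_ : (fun n => _) = (fun n => (err n)%:E + ((rho * c n 0%N)%:E +
    (\sum_(r < n.+1) first_run_ac rho n.+2 r * c n r)%:E)))%E; last first.
  by apply/funext => n; rewrite -!EFinD /err subrK.
rewrite -[((rho * Psi 0)%:E + _)%E]add0e.
apply: cvgeD; first exact: fin_num_adde_defr.
  by apply: cvg_EFin => //; exact: nearW.
apply: cvgeD; first exact: fin_num_adde_defr.
  apply: cvg_EFin; first exact: nearW.
  apply: cvgM; first exact: cvg_cst.
  (* At a = 0 the integer part is r = 0 for every n, which gives the contribution of the atom. *)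
  have := cPsi 0; rewrite lexx ltr01 => /(_ isT).
  by under eq_fun do rewrite mulr0 truncn0.
by apply: (cvg_sum_first_run_ac _ rho01 c Psi C) => // n r _; exact: cC.
Unshelve. all: by end_near.
Qed.

End convergence.

Theorem theorem1p3 (R : realType) (rho : R) (rho01 : 0 < rho < 1)
    (k : nat) (hk : (1 <= k)%N) :
  cvg_in_law (fun n => YF n)
    (fun n w => clone_measure (charlier_x rho) (charlier_y rho) w)
    (fun n w => run_ratios k w)
    (iid_law (eta_law rho01) k).
Proof.
move=> f cf bf; have [M [_ fM]] := bf.
have [C fC] : exists C, forall v, `|f v| <= C.
  by exists (M + 1) => v; apply: fM => //; rewrite ltrDl.
(* The shift makes the test function nonnegative, as [cvg_charlier_mean] requires; it is subtracted
   again at the end because both laws have total mass 1. *)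
pose g v := f v + C.
have cg : continuous g by move=> v; exact: (cvgD (cf v) (cvg_cst C)).
have gC v : 0 <= g v <= C + C.
  by have := fC v; rewrite ler_norml /g => /andP[f1 f2]; rewrite -lerBlDr sub0r f1 lerD2r.
have cvg_mean := cvg_charlier_mean rho rho01 k g (C + C) 0 cg gC.
set nu := iid_law (eta_law rho01) k.
pose F (t : k.-tuple (measurableTypeR R)) := f (\row_j tnth t j).
have mF : measurable_fun setT F by exact: measurable_fun_row.
have iF : nu.-integrable setT (EFin \o F).
  apply: measurable_bounded_integrable => //.
    by rewrite (le_lt_trans (probability_le1 _ _))// ltry.
  exists C; split; first exact: num_real.
  by move=> x Cx t _; exact: le_trans (fC _) (ltW Cx).
have iC : nu.-integrable setT (EFin \o cst C).
  exact: finite_measure_integrable_cst.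
have gE : (\int[nu]_t (g (\row_j tnth t j))%:E = (\int[nu]_t F t + C)%:E)%E.
  have -> : (\int[nu]_t (g (\row_j tnth t j))%:E =
      \int[nu]_t (F t)%:E + \int[nu]_t C%:E)%E.
    by rewrite -integralD.
  rewrite integral_iid_law_cst /Rintegral EFinD fineK//.
  exact: integrable_fin_num.
have {}cvg_mean : charlier_mean rho n (fun w => g (ratio_row k (n + 0) w))
    @[n --> \oo] --> \int[nu]_t F t + C.
  by move: cvg_mean; rewrite -/nu gE => /fine_cvg.
rewrite (_ : (fun n => _) = (fun n =>
    charlier_mean rho n (fun w => g (ratio_row k (n + 0) w)) - C)).
  by rewrite -[X in _ --> X](addrK C); apply: cvgB => //; exact: cvg_cst.
apply/funext => n; rewrite (charlier_meanE rho n (fun w => f (ratio_row k n w))).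
rewrite -[X in _ - X](charlier_mean_cst rho rho01 n) -charlier_meanB.
by congr charlier_mean; apply/funext => w; rewrite addn0 addrK.
Qed.
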